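(* Let $\natural: U^+_q \to \mathbb V$ be the algebra homomorphism from $U^+_q$ to the $q$-shuffle algebra $(\mathbb V,\star)$ that sends $A\mapsto x$ and $B\mapsto y$. Then for every integer $n\geq 1$, \[ \natural\bigl(E^{\rm Beck}_{n\delta}\bigr) = \frac{[2n]_q}{n}\, q^{-2n}(q-q^{-1})^{2n-1}\, x C_{n-1} y , \] where $xC_{n-1}y$ denotes the free (concatenation) product in $\mathbb V$.
   Context: $\mathbb F$ is a field of characteristic zero and $q\in\mathbb F$ is nonzero and not a root of unity; $[n]_q=(q^n-q^{-n})/(q-q^{-1})$. For elements $X,Y$ of an algebra, $[X,Y]=XY-YX$ and $[X,Y]_q=qXY-q^{-1}YX$. $U^+_q$ is the $\mathbb F$-algebra with generators $A,B$ and relations $[A,[A,[A,B]_q]_{q^{-1}}]=0$, $[B,[B,[B,A]_q]_{q^{-1}}]=0$. Define elements of $U^+_q$ recursively: $E_{\alpha_0}=A$, $E_{\alpha_1}=B$, $E_\delta=q^{-2}BA-AB$, and for $n\geq1$: $E_{n\delta+\alpha_0}=[E_\delta,E_{(n-1)\delta+\alpha_0}]/(q+q^{-1})$, $E_{n\delta+\alpha_1}=[E_{(n-1)\delta+\alpha_1},E_\delta]/(q+q^{-1})$, $E_{n\delta}=q^{-2}E_{(n-1)\delta+\alpha_1}A-AE_{(n-1)\delta+\alpha_1}$. Define $\{E^{\rm Beck}_{n\delta}\}_{n\ge1}\subseteq U^+_q$ by the identity of formal power series in an indeterminate $t$: $\exp\bigl((q-q^{-1})\sum_{k\ge1}E^{\rm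 Beck}_{k\delta}t^k\bigr)=1-(q-q^{-1})\sum_{k\ge1}E_{k\delta}t^k$. $\mathbb V$ is the free algebra on noncommuting letters $x,y$; a word is a product of letters (the empty word is $1$), and words form a basis. The $q$-shuffle product $\star$ on $\mathbb V$ is the bilinear product with $1\star v=v\star 1=v$ and, for nontrivial words $u=u_1\cdots u_r$, $v=v_1\cdots v_s$ (letters $u_i,v_j$), $u\star v=u_1\bigl((u_2\cdots u_r)\star v\bigr)+v_1\bigl(u\star(v_2\cdots v_s)\bigr)q^{(u_1,v_1)+(u_2,v_1)+\cdots+(u_r,v_1)}$, where juxtaposition is concatenation and $(x,x)=(y,y)=2$, $(x,y)=(y,x)=-2$. This makes $\mathbb V$ an associative algebra in which $x,y$ satisfy the $q$-Serre relations, so $\natural$ exists. Set $\overline x=1$, $\overline y=-1$. A word $u_1\cdots u_n$ is Catalan if $\overline u_1+\cdots+\overline u_i\ge0$ for $1\le i\le n-1$ and $=0$ for $i=n$. For $n\in\mathbb N$, $C_n=\sum u_1u_2\cdots u_{2n}\,[1]_q[1+\overline u_1]_q[1+\overline u_1+\overline u_2]_q\cdots[1+\overline u_1+\cdots+\overline u_{2n}]_q$, summed over all Catalan words of length $2n$ (so $C_0=1$). *)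

(* Defs.v *)
From HB Require Import structures.
From mathcomp Require Import all_boot all_order all_algebra.
From mathcomp Require Import finmap.
From mathcomp.multinomials Require Import monalg.

Set Implicit Arguments.
Unset Strict Implicit.
Unset Printing Implicit Defensive.

Import Order.TTheory GRing.Theory Num.Theory.
Local Open Scope ring_scope.

Notation lx := true.
Notation ly := false.

(* The free algebra V on x, y: finitely supported F-linear combinations of
   words; its ring product is concatenation. *)
Definition Vfree (F : fieldType) := {malg F[{fmonom bool}]}.

Section Defs.
Context (F : fieldType) (q : F).

Local Notation V := (Vfree F).

Definition wrd (s : seq bool) : V := << FMonom s >>.

Definition pairing (a b : bool) : int := if a == b then 2%Z else (-2)%Z.

Definition wpair (u : seq bool) (b : bool) : int :=
  \sum_(a <- u) pairing a b.

Fixpoint shw (u : seq bool) : seq bool -> V :=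
  match u with
  | [::] => fun v => wrd v
  | a :: u' =>
      fix shv (v : seq bool) : V :=
        match v with
        | [::] => wrd (a :: u')
        | b :: v' => wrd [:: a] * shw u' v
                     + (q ^ (wpair (a :: u') b)) *: (wrd [:: b] * shv v')
        end
  end.

Definition qstar (f g : V) : V :=
  \sum_(u <- msupp f) \sum_(v <- msupp g)
     (f@_u * g@_v) *: shw (fmonom_val u) (fmonom_val v).

Definition qint (n : int) : F := (q ^ n - q ^ (- n)) / (q - q^-1).

Definition lbar (a : bool) : int := if a then 1%Z else (-1)%Z.
Definition psum (s : seq bool) : int := \sum_(a <- s) lbar a.

Definition catalan (w : seq bool) : bool :=
  all (fun i => 0 <= psum (take i w)) (iota 1 (size w).-1)
  && (psum w == 0).

Definition Ccat (n : nat) : V :=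
  \sum_(w : (2 * n).-tuple bool | catalan w)
     (\prod_(i < (2 * n).+1) qint (1 + psum (take i w))) *: wrd w.

Section Alg.
Context (U : algType F) (A B : U).

Definition qcomm (c : F) (X Y : U) : U := c *: (X * Y) - c^-1 *: (Y * X).

Definition Edelta : U := q ^- 2 *: (B * A) - A * B.

Fixpoint Ea1 (n : nat) : U :=
  match n with
  | 0 => B
  | n'.+1 => (q + q^-1)^-1 *: (Ea1 n' * Edelta - Edelta * Ea1 n')
  end.

Definition Endelta (n : nat) : U :=
  q ^- 2 *: (Ea1 n.-1 * A) - A * Ea1 n.-1.

(* coefficient of t^n in P(t)^m, where P(t) = sum_k p k t^k *)
Fixpoint pcoef (p : nat -> U) (m n : nat) : U :=
  match m with
  | 0 => (n == 0%N)%:R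
  | m'.+1 => \sum_(k < n.+1) p k * pcoef p m' (n - k)
  end.

(* coefficient of t^n in exp(P(t)) when p 0 = 0 (terms m > n vanish) *)
Definition expcoef (p : nat -> U) (n : nat) : U :=
  \sum_(m < n.+1) (m`!%:R : F)^-1 *: pcoef p m n.

(* Eb is the Beck sequence: for all n >= 1, coefficient of t^n in
   exp((q-q^-1) sum_k Eb_k t^k) equals that of 1 - (q-q^-1) sum_k E_{k delta} t^k *)
Definition is_Beck (Eb : nat -> U) : Prop :=
  forall n, (0 < n)%N ->
    expcoef (fun k => if k is 0 then 0 else (q - q^-1) *: Eb k) n
    = - ((q - q^-1) *: Endelta n).

End Alg.
End Defs.

(* Main.v *)
(** The q-shuffle algebra is completed to all functions on words.  There the
    left derivatives [d_x], [d_y] (strip the first letter) satisfy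
    [d_a (f g) = d_a f g + K_a f d_a g], with [K_a] scaling a word [u] by
    [q ^ (u, a)], so an identity between products of series follows by induction
    on words once it sits in a family that is closed under [d_x] and [d_y].

    Let [D_m] and [F_m] be the series of weighted walks from height [m] to
    [0] and to [1], so that [F_1] is the sum of the [C_n] and [P = x D_1] the sum of
    the [x C_(n-1) y], and put [G(t) = sum_n t^n (xy)^n], [k = q - q^-1].  Closed
    families yield
    - the brackets of [D_1] with [x] and [xy], which give Damiani's elements:
      [-k E_(n delta)] goes to [(q^-2 k^2)^n C_n];
    - [G(-1/q) F_1 G(-q) = 1], and the commutativity of the [(xy)^n];
    - [theta G(-1) = - (sum_n [n] x C_(n-1) y) G(-1)], where [theta] counts the
      letters [y]; hence the [x C_(n-1) y] lie in the commutative algebra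
      generated by the [(xy)^n].
    Together they give [theta F_1 = (sum_n [2n] x C_(n-1) y) F_1], that is
    [F_1 = exp (sum_n [2n]/n x C_(n-1) y)], and a series is determined by its
    exponential. *)

Require Import Defs.
From HB Require Import structures.
From mathcomp Require Import all_boot all_order all_algebra.
From mathcomp Require Import finmap.
From mathcomp.multinomials Require Import monalg.
From mathcomp Require Import ring.
From mathcomp Require boolp.
Import Order.TTheory GRing.Theory Num.Theory.
Local Open Scope ring_scope.

Set Implicit Arguments.
Unset Strict Implicit.
Unset Printing Implicit Defensive.

(** * The completed q-shuffle algebra *)

(* The proof [q_neq0] is a parameter of the type because associativity of the
   product needs it. *)
Definition qser (F : fieldType) (q : F) (q_neq0 : q != 0) := seq bool -> F.

HB.instance Definition _ (F : fieldType) (q : F) (q_neq0 : q != 0) :=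
  boolp.gen_eqMixin (qser q_neq0).
HB.instance Definition _ (F : fieldType) (q : F) (q_neq0 : q != 0) :=
  boolp.gen_choiceMixin (qser q_neq0).

Section QShuffle.
Context (F : fieldType) (q : F) (q_neq0 : q != 0).
Local Notation T := (qser q_neq0).
Implicit Types (f g h : T) (a b : bool) (u w : seq bool) (c : F).

Lemma qserP f g : f =1 g -> f = g.
Proof. exact: boolp.funext. Qed.

Fact qser_addA : associative (fun f g : T => (fun w => f w + g w) : T).
Proof. by move=> f g h; apply: qserP => w; rewrite addrA. Qed.
Fact qser_addC : commutative (fun f g : T => (fun w => f w + g w) : T).
Proof. by move=> f g; apply: qserP => w; rewrite addrC. Qed.
Fact qser_add0 : left_id ((fun=> 0) : T) (fun f g : T => (fun w => f w + g w) : T).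
Proof. by move=> f; apply: qserP => w; rewrite add0r. Qed.
Fact qser_addN : left_inverse ((fun=> 0) : T) (fun f : T => (fun w => - f w) : T)
  (fun f g : T => (fun w => f w + g w) : T).
Proof. by move=> f; apply: qserP => w; rewrite addNr. Qed.

HB.instance Definition _ :=
  GRing.isZmodule.Build T qser_addA qser_addC qser_add0 qser_addN.

Fact qser_scaleA c d f :
  (fun w => c * (d * f w)) = (fun w => c * d * f w) :> T.
Proof. by apply: qserP => w; rewrite mulrA. Qed.
Fact qser_scale1 : left_id 1 (fun c f => (fun w => c * f w) : T).
Proof. by move=> f; apply: qserP => w; rewrite mul1r. Qed.
Fact qser_scaleDr : right_distributive (fun c f => (fun w => c * f w) : T) +%R.
Proof. by move=> c f g; apply: qserP => w; apply: mulrDr. Qed.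
Fact qser_scaleDl f :
  {morph (fun c => (fun w => c * f w) : T) : c d / c + d}.
Proof. by move=> c d; apply: qserP => w; apply: mulrDl. Qed.

HB.instance Definition _ := GRing.Zmodule_isLmodule.Build F T
  qser_scaleA qser_scale1 qser_scaleDr qser_scaleDl.

Lemma qserD f g w : (f + g) w = f w + g w. Proof. by []. Qed.
Lemma qserN f w : (- f) w = - f w. Proof. by []. Qed.
Lemma qserB f g w : (f - g) w = f w - g w. Proof. by []. Qed.
Lemma qserZ c f w : (c *: f) w = c * f w. Proof. by []. Qed.
Lemma qser0 w : (0 : T) w = 0. Proof. by []. Qed.
Definition qserE := (qserD, qserN, qserZ, qser0).

Definition lder a f : T := fun w => f (a :: w).
Definition twist a f : T := fun w => q ^ wpair w a * f w.

Lemma lderD a f g : lder a (f + g) = lder a f + lder a g. Proof. by []. Qed.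
Lemma lderZ a c f : lder a (c *: f) = c *: lder a f. Proof. by []. Qed.
Lemma twistD a f g : twist a (f + g) = twist a f + twist a g.
Proof. by apply: qserP => w; rewrite /twist !qserE mulrDr. Qed.
Lemma twistZ a c f : twist a (c *: f) = c *: twist a f.
Proof. by apply: qserP => w; rewrite /twist !qserE mulrCA. Qed.
Lemma twistC a b f : twist a (twist b f) = twist b (twist a f).
Proof. by apply: qserP => w; rewrite /twist mulrCA. Qed.

Lemma wpair_nil a : wpair [::] a = 0. Proof. by rewrite /wpair big_nil. Qed.
Lemma wpair_cons b u a : wpair (b :: u) a = pairing b a + wpair u a.
Proof. by rewrite /wpair big_cons. Qed.

Lemma lder_twist a b f : lder b (twist a f) = q ^ pairing b a *: twist a (lder b f).
Proof.
by apply: qserP => w; rewrite /lder /twist wpair_cons expfzDr // qserE mulrA.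
Qed.

(** The twisted Leibniz rule, read as a recursion on the output word. Each coefficient of a product
    involves finitely many coefficients of the factors, and [lder_mul] holds by conversion. *)
Fixpoint mulw (w : seq bool) (f g : T) : F :=
  match w with
  | [::] => f [::] * g [::]
  | a :: w' => mulw w' (lder a f) g + mulw w' (twist a f) (lder a g)
  end.

Definition qser_mul f g : T := fun w => mulw w f g.
Definition qser_one : T := fun w => (w == [::])%:R.

Lemma mulwDl w f f' g : mulw w (f + f') g = mulw w f g + mulw w f' g.
Proof.
elim: w f f' g => [|a w IH] f f' g /=; first by rewrite qserE mulrDl.
by rewrite lderD twistD !IH addrACA.
Qed.
Lemma mulwDr w f g g' : mulw w f (g + g') = mulw w f g + mulw w f g'.
Proof.
elim: w f g g' => [|a w IH] f g g' /=; first by rewrite qserE mulrDr.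
by rewrite lderD !IH addrACA.
Qed.
Lemma mulwZl w c f g : mulw w (c *: f) g = c * mulw w f g.
Proof.
elim: w f g => [|a w IH] f g /=; first by rewrite qserE mulrA.
by rewrite lderZ twistZ !IH mulrDr.
Qed.
Lemma mulwZr w c f g : mulw w f (c *: g) = c * mulw w f g.
Proof.
elim: w f g => [|a w IH] f g /=; first by rewrite qserE mulrCA.
by rewrite lderZ !IH mulrDr.
Qed.
Lemma mulw0l w g : mulw w 0 g = 0.
Proof. by rewrite -(scale0r 0) mulwZl mul0r. Qed.
Lemma mulw0r w f : mulw w f 0 = 0.
Proof. by rewrite -(scale0r 0) mulwZr mul0r. Qed.

Lemma lder_mul a f g :
  lder a (qser_mul f g) = qser_mul (lder a f) g + qser_mul (twist a f) (lder a g).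
Proof. by []. Qed.

(** The weight of a word is additive in its letters and a shuffle only rearranges letters.
    Associativity rests on this. *)
Lemma twist_mul a f g : twist a (qser_mul f g) = qser_mul (twist a f) (twist a g).
Proof.
apply: qserP => w; rewrite /twist /qser_mul.
elim: w f g => [|b w IH] f g /=.
  by rewrite /twist wpair_nil expr0z !mul1r.
rewrite !lder_twist mulwZl mulwZr twistC -!IH wpair_cons expfzDr //.
by rewrite mulrDr !mulrA.
Qed.

Fact qser_mulA : associative qser_mul.
Proof.
move=> f g h; apply: qserP => w; rewrite /qser_mul.
elim: w f g h => [|a w IH] f g h /=; first by rewrite mulrA.
rewrite -/(qser_mul g h) -/(qser_mul f g) !lder_mul twist_mul mulwDl mulwDr.
by rewrite !IH addrA.
Qed.

Lemma lder_one a : lder a qser_one = 0. Proof. by apply: qserP. Qed.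
Lemma twist_one a : twist a qser_one = qser_one.
Proof.
by apply: qserP => -[|b w]; rewrite /twist ?mulr0 // wpair_nil mul1r.
Qed.

Fact qser_mul1 : left_id qser_one qser_mul.
Proof.
move=> f; apply: qserP => w; rewrite /qser_mul.
elim: w f => [|a w IH] f /=; first by rewrite mul1r.
by rewrite lder_one mulw0l add0r twist_one IH.
Qed.
Fact qser_1mul : right_id qser_one qser_mul.
Proof.
move=> f; apply: qserP => w; rewrite /qser_mul.
elim: w f => [|a w IH] f /=; first by rewrite mulr1.
by rewrite lder_one mulw0r addr0 IH.
Qed.
Fact qser_mulDl : left_distributive qser_mul +%R.
Proof. by move=> f g h; apply: qserP => w; apply: mulwDl. Qed.
Fact qser_mulDr : right_distributive qser_mul +%R.
Proof. by move=> f g h; apply: qserP => w; apply: mulwDr. Qed.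
Fact qser_oner_neq0 : qser_one != 0.
Proof.
by apply/eqP => /(congr1 (fun f : T => f [::]))/eqP; rewrite oner_eq0.
Qed.

HB.instance Definition _ := GRing.Zmodule_isNzRing.Build T
  qser_mulA qser_mul1 qser_1mul qser_mulDl qser_mulDr qser_oner_neq0.

Fact qser_scalerAl c f g : c *: (f * g) = (c *: f) * g.
Proof. by apply: qserP => w; rewrite qserZ [RHS]mulwZl. Qed.
HB.instance Definition _ := GRing.Lmodule_isLalgebra.Build F T qser_scalerAl.

Fact qser_scalerAr c f g : c *: (f * g) = f * (c *: g).
Proof. by apply: qserP => w; rewrite qserZ [RHS]mulwZr. Qed.
HB.instance Definition _ := GRing.Lalgebra_isAlgebra.Build F T qser_scalerAr.

End QShuffle.

(** * Series of walks and of alternating words *)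

Section Walks.
Context (F : fieldType) (q : F) (q_neq0 : q != 0).
Local Notation T := (qser q_neq0).
Implicit Types (f g h : T) (a b : bool) (u w : seq bool) (c : F).

Definition qnat (m : nat) : F := (q ^+ m - q ^- m) / (q - q^-1).

Lemma qnat0 : qnat 0 = 0. Proof. by rewrite /qnat expr0 invr1 subrr mul0r. Qed.

Lemma wpairE w a : wpair w a = 2 * lbar a * psum w.
Proof.
elim: w => [|b w IH]; first by rewrite wpair_nil /psum big_nil mulr0.
by rewrite wpair_cons IH /psum big_cons mulrDr; congr (_ + _); case: a {IH}; case: b.
Qed.

Lemma psum_cons a w : psum (a :: w) = lbar a + psum w.
Proof. by rewrite /psum big_cons. Qed.
Lemma psum_nil : psum [::] = 0. Proof. by rewrite /psum big_nil. Qed.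

(** The series below are supported on words with a fixed excess of [x] over [y], so twisting
    rescales them; this lets families of identities close under [lder]. *)
Lemma twist_homog a f (d : int) : (forall w, f w != 0 -> psum w = d) ->
  twist a f = q ^ (2 * lbar a * d) *: f.
Proof.
move=> fd; apply: qserP => w; rewrite qserZ /twist wpairE.
by have [->|/fd ->] := eqVneq (f w) 0; rewrite ?mulr0.
Qed.

(* Walks from height [m] to height [e], the letter [x] going up and [y] going
   down, weighted by [[height]] at the start of each step.  As [[0] = 0] no walk
   leaves height [0], so the truncation in [m.-1] is harmless. *)
Fixpoint walk (e m : nat) (w : seq bool) : F :=
  match w with
  | [::] => (m == e)%:R
  | a :: w' => qnat m * walk e (if a then m.+1 else m.-1) w'
  end.

(* [altw true s] is the sum of the [s n (xy)^n], and [altw false s] its left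
   derivative by [x], the sum of the [s n.+1 y(xy)^n]. *)
Fixpoint altw (b : bool) (s : nat -> F) (w : seq bool) : F :=
  match w with
  | [::] => if b then s 0 else 0
  | a :: w' => if a == b then altw (~~ b) (if b then s else s \o succn) w' else 0
  end.

Definition walk0 m : T := walk 0 m.
Definition walk1 m : T := walk 1 m.
Definition altG s : T := altw true s.
Definition altW s : T := altw false s.
Local Notation D := walk0.
Local Notation Fw := walk1.
Local Notation G := altG.
Local Notation W := altW.
Definition letter a : T := fun w => (w == [:: a])%:R.
Local Notation X := (letter true).
Local Notation Y := (letter false).
Definition xwalk : T := fun w => if w is true :: w' then D 1 w' else 0.
Local Notation P := xwalk.

Lemma lder_walk0 a m : lder a (D m) = qnat m *: D (if a then m.+1 else m.-1).
Proof. by []. Qed.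
Lemma lder_walk1 a m : lder a (Fw m) = qnat m *: Fw (if a then m.+1 else m.-1).
Proof. by []. Qed.
Lemma lder_altG a s : lder a (G s) = if a then W s else 0.
Proof. by apply: qserP => w; case: a. Qed.
Lemma lder_altW a s : lder a (W s) = if a then 0 else G (s \o succn).
Proof. by apply: qserP => w; case: a. Qed.
Lemma lder_letter a b : lder a (letter b) = (a == b)%:R *: 1.
Proof.
apply: qserP => w; rewrite qserZ /lder /letter eqseq_cons.
by case: eqP => _; rewrite ?mul1r ?mul0r.
Qed.
Lemma lder_xwalk a : lder a P = if a then D 1 else 0.
Proof. by apply: qserP => w; case: a. Qed.

Lemma walk_homog e m w : walk e m w != 0 -> psum w = e%:Z - m%:Z.
Proof.
elim: w m => [|a w IH] m /=.
  by have [->|] := eqVneq m e; rewrite ?eqxx // psum_nil subrr.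
rewrite mulf_eq0 negb_or psum_cons => /andP[m0 /IH ->].
case: a => /=; first by rewrite -addn1 PoszD; ring.
case: m m0 => [|m] /=; first by rewrite qnat0 eqxx.
by move=> _; rewrite -addn1 PoszD; ring.
Qed.

Lemma altw_homog b s w : altw b s w != 0 -> psum w = if b then 0 else -1.
Proof.
elim: w b s => [|a w IH] b s /=; first by case: b; rewrite ?eqxx // psum_nil.
have [->|] := eqVneq a b; rewrite ?eqxx // psum_cons => /IH ->.
by case: b.
Qed.

Lemma twist_walk0 a m :
  twist a (D m) = (if a then q ^- (2 * m) else q ^+ (2 * m)) *: D m.
Proof.
rewrite (@twist_homog a (D m) (- m%:Z)); last first.
  by move=> w /walk_homog ->; rewrite sub0r.
congr (_ *: _); case: a => /=.
  by rewrite exprnN; congr (q ^ _); rewrite PoszM; ring.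
by rewrite -[RHS]/(q ^ (2 * m)%N); congr (q ^ _); rewrite PoszM; ring.
Qed.
Lemma twist_altG a s : twist a (G s) = G s.
Proof.
rewrite (@twist_homog a _ 0); last by move=> w /altw_homog.
by rewrite mulr0 expr0z scale1r.
Qed.
Lemma twist_altW a s : twist a (W s) = (if a then q ^- 2 else q ^+ 2) *: W s.
Proof.
rewrite (@twist_homog a _ (- 1)); last by move=> w /altw_homog.
by case: a.
Qed.
Lemma twist_letter a b :
  twist a (letter b) = (if a == b then q ^+ 2 else q ^- 2) *: letter b.
Proof.
rewrite (@twist_homog a _ (lbar b)); first by case: a; case: b.
move=> w; rewrite /letter; have [->|] := eqVneq w [:: b]; rewrite ?eqxx // => _.
by rewrite psum_cons psum_nil addr0.
Qed.
Lemma twist_xwalk a : twist a P = P.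
Proof.
rewrite (@twist_homog a _ 0); first by rewrite mulr0 expr0z scale1r.
move=> [|[] w] /=; rewrite ?eqxx // => /walk_homog.
by rewrite psum_cons => ->.
Qed.

Lemma mulw_nil f g : mulw [::] f g = f [::] * g [::]. Proof. by []. Qed.
Lemma mulw_cons a w f g :
  mulw (a :: w) f g = mulw w (lder a f) g + mulw w (twist a f) (lder a g).
Proof. by []. Qed.
Lemma mulw1l w g : mulw w (1 : T) g = g w.
Proof. by rewrite -[LHS]/((1 * g) w) mul1r. Qed.
Lemma mulw1r w f : mulw w f (1 : T) = f w.
Proof. by rewrite -[LHS]/((f * 1) w) mulr1. Qed.
Lemma lderM a f g : lder a (f * g) = lder a f * g + twist a f * lder a g.
Proof. by []. Qed.
Lemma twistM a f g : twist a (f * g) = twist a f * twist a g.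
Proof. exact: twist_mul. Qed.
Lemma walk_cons e m a w :
  walk e m (a :: w) = qnat m * walk e (if a then m.+1 else m.-1) w.
Proof. by []. Qed.

Definition lderE := (lderM, lderD, lderZ, lder_walk0, lder_walk1, lder_altG,
  lder_altW, lder_letter, lder_xwalk).
Definition twistE := (twistM, twistD, twistZ, twist_walk0, twist_altG,
  twist_altW, twist_letter, twist_xwalk).
Definition mulwE := (mulwDl, mulwDr, mulwZl, mulwZr, mulw0l, mulw0r, mulw1l, mulw1r,
  eqxx, scale1r, scale0r, mulr0, mulr1, mul0r).
End Walks.

(** * Exchange relations between walk series, letters and alternating series *)

Section Relations.
Context (F : fieldType) (q : F) (q_neq0 : q != 0).
Hypothesis q2_neq1 : q ^+ 2 != 1.
Local Notation T := (qser q_neq0).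
Local Notation "[ m ]" := (qnat q m).
Local Notation k := (q - q^-1).
Local Notation D := (walk0 q_neq0).
Local Notation Fw := (walk1 q_neq0).
Local Notation G := (altG q_neq0).
Local Notation W := (altW q_neq0).
Local Notation X := (letter q_neq0 true).
Local Notation Y := (letter q_neq0 false).
Implicit Types (f g h : T) (a b : bool) (u w : seq bool) (c : F).

Lemma qqV_neq0 : k != 0.
Proof.
apply: contraNneq q2_neq1 => /eqP; rewrite subr_eq0 => /eqP e.
by rewrite expr2 {2}e divff.
Qed.
Lemma qq_neq1 : q * q - 1 != 0. Proof. by rewrite subr_eq0 -expr2. Qed.

Lemma q_expr_neq0 m : q ^+ m != 0. Proof. exact: expf_neq0. Qed.

Lemma qnat1 : [1] = 1. Proof. by rewrite /qnat !expr1 divff ?qqV_neq0. Qed.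

(** In the inductions below the goal becomes a multiple of one induction hypothesis; only the
    multiplier [c] has to be supplied. *)
Lemma lincomb1 c (e e' : F) : e = 0 -> e' = c * e -> e' = 0.
Proof. by move=> -> ->; rewrite mulr0. Qed.

Lemma lincomb2 (e1 e2 e' : F) : e1 = 0 -> e2 = 0 -> e' = e1 + e2 -> e' = 0.
Proof. by move=> -> -> ->; rewrite addr0. Qed.

(** [q ^+ m] is replaced by a fresh nonzero variable, so that [field] sees a rational identity
    without symbolic exponents. *)
Local Ltac qfield m :=
  rewrite /qnat ?mulnS ?mul0n ?mul2n -?addnn ?add0n ?exprS ?exprD ?expr0;
  generalize (q_expr_neq0 m); generalize (q ^+ m);
  let Q := fresh "Q" in let Q0 := fresh "Q0" in intros Q Q0;
  field; do ?[apply/andP; split]; rewrite ?q_neq0 ?qqV_neq0 ?qq_neq1 ?oner_neq0 //.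

Local Ltac qfield0 := rewrite ?qnat0 ?qnat1 ?muln0 ?muln1 ?expr0;
  field; do ?[apply/andP; split]; rewrite ?q_neq0 ?qqV_neq0 ?qq_neq1 ?oner_neq0 //.

(** The derivatives by [x] and [y] turn the relation for [m] into multiples of those for [m.+1] and
    [m.-1], so all [m] are treated together; the case [m = 1] becomes [walk1_eq]. *)
Lemma walk0_letterx m w : q ^- (2 * m) * mulw w (D m) X - mulw w X (D m)
  + q ^- (2 * m) * k * (Fw m w - [m] * D m.-1 w) = 0.
Proof.
elim: w m => [|a w IH] m.
  rewrite !mulw_nil /D /Fw /= /letter /=.
  by case: m => [|[|m]] /=; rewrite ?qnat0 ?qnat1 ?(mulr0, mul0r, mulr1, subrr, addr0).
rewrite !mulw_cons !lderE !twistE !mulwE [Fw m _]walk_cons [D m.-1 _]walk_cons.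
rewrite -/(D _) -/(Fw _).
case: a => /=.
  apply: (lincomb1 (IH m.+1) (c := q ^+ 2 * [m])).
  (* At [m = 0] the predecessor is truncated, but it only occurs next to the factor [[0] = 0]. *)
  case: m => [|m] /=; last by qfield m.
  by qfield0.
apply: (lincomb1 (IH m.-1) (c := q ^- 2 * [m])).
case: m => [|m] /=; last by qfield m.
by qfield0.
Qed.

Lemma lettery_walk0 m w : mulw w Y (D m) - q ^+ (2 * m) * mulw w (D m) Y
  + k * q ^+ (2 * m) * [m] * D m.+1 w = 0.
Proof.
elim: w m => [|a w IH] m.
  by rewrite !mulw_nil /D /= /letter /= !(mulr0, mul0r, addr0, subrr).
rewrite !mulw_cons !lderE !twistE !mulwE [D _ (_ :: _)]walk_cons -/(D _).
case: a => /=.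
  by apply: (lincomb1 (IH m.+1) (c := q ^- 2 * [m])); qfield m.
apply: (lincomb1 (IH m.-1) (c := q ^+ 2 * [m])).
case: m => [|m] /=; last by qfield m.
by qfield0.
Qed.

Definition wordxy : T := fun w => (w == [:: true; false])%:R.
Local Notation XY := wordxy.
Lemma lder_wordxy a : lder a XY = if a then Y else 0.
Proof. by apply: qserP => w; case: a. Qed.
Lemma twist_wordxy a : twist a XY = XY.
Proof.
rewrite (@twist_homog _ _ _ a XY 0); first by rewrite mulr0 expr0z scale1r.
move=> w; rewrite /XY; have [->|] := eqVneq w [:: true; false]; rewrite ?eqxx // => _.
by rewrite !psum_cons psum_nil.
Qed.

Lemma walk0_wordxy m w : mulw w (D m) XY - mulw w XY (D m)
  - k * [m] * (mulw w (D m.-1) Y - q ^+ m / q * D m w) = 0.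
Proof.
elim: w m => [|a w IH] m.
  rewrite !mulw_nil /D /= /letter /XY /=.
  by case: m => [|m] /=; rewrite ?qnat0 !(mulr0, mul0r, addr0, subrr).
rewrite !mulw_cons !(lderE, lder_wordxy) !(twistE, twist_wordxy) !mulwE.
rewrite [D _ (_ :: _)]walk_cons -/(D _).
case: a => /=.
  rewrite !mulwE.
  (* The [x]-derivative of [XY] is [Y], which lands to the left of [D m]; [lettery_walk0] moves it
     to the right. *)
  have := lettery_walk0 m w; move/eqP; rewrite -addrA addr_eq0 => /eqP ->.
  apply: (lincomb1 (IH m.+1) (c := [m])).
  case: m => [|m] /=; last by qfield m.
  by qfield0.
rewrite !mulwE.
apply: (lincomb1 (IH m.-1) (c := [m])).
case: m => [|m] /=; last by qfield m.
by qfield0.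
Qed.

Definition geo (t : F) : nat -> F := fun n => t ^+ n.

(** Geometric coefficients make the pair [G], [W] stable under both derivatives up to scalars. *)
Lemma altG_geoS t : G (geo t \o succn) = t *: G (geo t).
Proof.
have E b w c s : altw b (fun n => c * s n) w = c * altw b s w.
  elim: w b s => [|a w IH] b s /=; first by case: b; rewrite ?mulr0.
  by case: eqP => _; rewrite ?mulr0 //; case: b; rewrite IH.
apply: qserP => w; rewrite qserZ -E; congr (altw _ _ w).
by apply: boolp.funext => n; rewrite /= /geo exprS.
Qed.

(* The two-row R-matrix between the walk series and [G(t)] degenerates at
   [t = -q] and [t = -q^-1]; these are the only parameters needed below. *)
Lemma walk0_altG m w : q ^+ m.+1 * mulw w (D m.+1) (G (geo (- q)))
  + mulw w (D m) (W (geo (- q))) = 0.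
Proof.
elim: w m => [|a w IH] m.
  by rewrite !mulw_nil /D /= /W /= !(mulr0, mul0r, addr0, subrr).
rewrite !mulw_cons !lderE !twistE altG_geoS !mulwE.
case: a => /=; rewrite ?mulwE.
  by apply: (lincomb1 (IH m.+1) (c := q^-1 * [m.+1])); qfield m.
case: m => [|m] /=.
  by rewrite qnat1; qfield0.
by apply: (lincomb1 (IH m) (c := [m.+1])); qfield m.
Qed.

Local Notation t := (- q^-1).
(** The coefficient in the first relation is [q ^+ m] times the q-integer of [m - 1], written out
    because at [m = 0] it has to be -1. It vanishes at [m = 1], which gives [g'_walk0_1]. *)
Lemma altG_walk0 m w :
  (mulw w (G (geo t)) (D m) + q ^+ m * (q ^+ m / q - q / q ^+ m) / k * mulw w (D m) (G (geo t))
   + q * [m] * mulw w (D m.-1) (W (geo t)) = 0) /\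
  (mulw w (W (geo t)) (D m) - q ^+ m * [m.+1] * mulw w (D m) (W (geo t))
   - q ^+ (2 * m) * [m] * mulw w (D m.+1) (G (geo t)) = 0).
Proof.
elim: w m => [|a w IH] m.
  rewrite !mulw_nil /D /= /W /= !(mulr0, mul0r, addr0, subrr); split=> //.
  case: m => [|m]; rewrite ?(mulr0, mul0r, addr0, subrr) //.
  by rewrite /G /= /geo; qfield0.
rewrite !mulw_cons !lderE !twistE altG_geoS !mulwE.
case: a => /=; rewrite ?mulwE.
  have [IH1 IH2] := IH m; have [IH3 IH4] := IH m.+1.
  (* The [x]-derivative of the first relation contains [W] times [D m]. Eliminating it by the second
     relation at [m] leaves a multiple of the first one at [m.+1]. *)
  move/eqP: IH2; rewrite -addrA addr_eq0 => /eqP IH2.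
  split.
    rewrite IH2.
    apply: (lincomb1 IH3 (c := [m])).
    case: m {IH1 IH2 IH3 IH4} => [|m] /=; last by qfield m.
    by qfield0.
  apply: (lincomb1 IH4 (c := q ^- 2 * [m])).
  case: m {IH1 IH2 IH3 IH4} => [|m] /=; last by qfield m.
  by qfield0.
have [IH1 _] := IH m; have [IH3 IH4] := IH m.-1.
move/eqP: IH1; rewrite -addrA addr_eq0 => /eqP IH1.
split.
  apply: (lincomb1 IH3 (c := [m])).
  case: m {IH1 IH3 IH4} => [|m] /=; last by qfield m.
  by qfield0.
rewrite IH1.
apply: (lincomb1 IH4 (c := q ^+ 2 * [m])).
case: m {IH1 IH3 IH4} => [|m] /=; last by qfield m.
by qfield0.
Qed.

(* Only the first component is wanted; the others close the family under [lder]. *)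
Lemma altG_comm_pointwise r s w :
  [/\ mulw w (G r) (G s) - mulw w (G s) (G r) = 0,
      mulw w (W r) (G s) - mulw w (G s) (W r) + mulw w (G r) (W s) - mulw w (W s) (G r) = 0,
      mulw w (W r) (W s) - mulw w (W s) (W r) = 0
    & mulw w (G (r \o succn)) (W s) + q ^+ 2 * mulw w (W r) (G (s \o succn))
      - mulw w (G (s \o succn)) (W r) - q ^+ 2 * mulw w (W s) (G (r \o succn)) = 0].
Proof.
elim: w r s => [|a w IH] r s.
  by rewrite !mulw_nil /G /W /= !(mulr0, mul0r, addr0, subrr) (mulrC (r 0)) subrr.
have [H1 H2 H3 H4] := IH r s.
have [H1x H2x H3x H4x] := IH (r \o succn) s.
have [H1y H2y H3y H4y] := IH r (s \o succn).
have [H1z H2z H3z H4z] := IH (r \o succn) (s \o succn).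
rewrite !mulw_cons !lderE !twistE !mulwE.
case: a => /=; rewrite ?mulwE; split.
- by rewrite -[RHS]H2; ring.
- by apply: (lincomb1 H3 (c := 1 + q ^- 2)); qfield0.
- by ring.
- by apply: (lincomb2 H3x H3y); qfield0.
- by ring.
- by apply: (lincomb2 H1x H1y); ring.
- by rewrite -[RHS]H4; ring.
- by apply: (lincomb1 H1z (c := 1 + q ^+ 2)); ring.
Qed.
End Relations.

(** * The grading by the number of letters y *)

Section Scaling.
Context (F : fieldType) (q : F) (q_neq0 : q != 0).
Local Notation T := (qser q_neq0).
Implicit Types (f g h : T) (a b : bool) (u w : seq bool) (c : F).

Definition ny (w : seq bool) : nat := count_mem false w.
(** The number of letters [y] serves as the exponent of a formal variable [t]: [sigma c] substitutes
    [c t] for [t], [theta] is [t d/dt], and [ycomp n] extracts the part of degree [n]. *)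
Definition yscale (p : nat -> F) f : T := fun w => p (ny w) * f w.
Definition sigma c := yscale (fun n => c ^+ n).
Definition theta := yscale (fun n => n%:R).
Definition ycomp (n : nat) := yscale (fun m => (m == n)%:R).

Lemma lder_yscale a p f :
  lder a (yscale p f) = yscale (if a then p else p \o succn) (lder a f).
Proof. by case: a. Qed.
Lemma twist_yscale a p f : twist a (yscale p f) = yscale p (twist a f).
Proof. by apply: qserP => w; rewrite /twist /yscale mulrCA. Qed.

Lemma yscale_is_linear p : linear (yscale p).
Proof.
move=> c f g; apply: qserP => w; rewrite /yscale !qserE.
by rewrite mulrDr mulrCA.
Qed.
HB.instance Definition _ p :=
  GRing.isLinear.Build F T T _ (yscale p) (yscale_is_linear p).

HB.instance Definition _ c := GRing.Linear.copy (sigma c) (yscale (fun n => c ^+ n)).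
HB.instance Definition _ n :=
  GRing.Linear.copy (ycomp n) (yscale (fun m => (m == n)%:R)).

Lemma lder_sigma a c f :
  lder a (sigma c f) = (if a then 1 else c) *: sigma c (lder a f).
Proof.
rewrite /sigma lder_yscale; apply: qserP => w; rewrite qserZ /yscale.
by case: a; rewrite ?mul1r //= exprS mulrA.
Qed.
Lemma lder_theta a f :
  lder a (theta f) = theta (lder a f) + (if a then 0 else lder a f).
Proof.
rewrite /theta lder_yscale; apply: qserP => w; rewrite qserD /yscale.
by case: a; rewrite ?addr0 //= -addn1 natrD mulrDl mul1r.
Qed.

Lemma twist_sigma a c f : twist a (sigma c f) = sigma c (twist a f).
Proof. exact: twist_yscale. Qed.
Lemma twist_theta a f : twist a (theta f) = theta (twist a f).
Proof. exact: twist_yscale. Qed.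

Lemma qserM_mulw f g w : (f * g) w = mulw w f g. Proof. by []. Qed.
Lemma qser_sum n (H : 'I_n -> T) w : (\sum_k H k) w = \sum_k H k w.
Proof. by elim/big_rec2: _ => // k c f _ <-. Qed.

(** Shuffling adds the numbers of letters [y]. For the same reason [theta] is a derivation and
    [ycomp] obeys the Cauchy product. *)
Lemma sigmaM c : {morph sigma c : f g / f * g}.
Proof.
move=> f g; apply: qserP => w; rewrite qserM_mulw {1}/sigma {1}/yscale qserM_mulw.
elim: w f g => [|a w IH] f g /=.
  by rewrite /sigma /yscale !expr0 !mul1r.
rewrite !lder_sigma mulwZl mulwZr twist_sigma -!IH.
by case: a; rewrite /= ?add0n ?add1n ?exprS; ring.
Qed.

Lemma thetaM f g : theta (f * g) = theta f * g + f * theta g.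
Proof.
apply: qserP => w; rewrite qserD !qserM_mulw {1}/theta {1}/yscale qserM_mulw.
elim: w f g => [|a w IH] f g /=.
  by rewrite /theta /yscale /= !mulr0n !mul0r mulr0 addr0.
rewrite !lder_theta !mulwDl !mulwDr twist_theta.
have := IH (lder a f) g; have := IH (twist a f) (lder a g).
case: a => /= H1 H2; rewrite mulrDr.
  by rewrite mulw0l mulw0r !addr0 add0n H1 H2 addrACA.
rewrite -mulrDr natrD mulrDl mul1r mulrDr H1 H2.
do ?[match goal with |- context [mulw ?u ?f1 ?g1] => generalize (mulw u f1 g1); intro end].
by ring.
Qed.

Lemma ycompM (n : nat) f g :
  ycomp n (f * g) = \sum_(k < n.+1) ycomp k f * ycomp (n - k)%N g.
Proof.
apply: qserP => w; rewrite qser_sum {1}/ycomp {1}/yscale qserM_mulw.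
under eq_bigr do rewrite qserM_mulw.
elim: w n f g => [|a w IH] n f g.
  rewrite /= /ycomp /yscale /=; case: n => [|n].
    by rewrite big_ord1 !eqxx !mul1r.
  rewrite mul0r big1 // => -[[|k] le_k] _ /=; last by rewrite !mul0r.
  by rewrite mul0r mulr0.
under eq_bigr do rewrite mulw_cons /ycomp !lder_yscale twist_yscale.
rewrite big_split /= -!/(ycomp _ _).
case: a; first by rewrite /= add0n mulrDr !IH.
(* A [y]-derivative lowers the degree, so a component of degree 0 has none; this removes one
   boundary term from each of the two sums. *)
have z0 h : yscale ((fun m : nat => (m == 0%N)%:R) \o succn) h = 0.
  by apply: qserP => u; rewrite /yscale /= mulr0n mul0r.
rewrite /= add1n; case: n => [|n].
  by rewrite !big_ord1 /= subn0 !z0 mulw0l mulw0r addr0 mulr0n mul0r.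
rewrite eqSS mulrDr !IH; congr (_ + _).
  rewrite [RHS]big_ord_recl /= z0 mulw0l add0r.
  by apply: eq_bigr => k _; rewrite /bump /= add1n subSS.
rewrite [RHS]big_ord_recr /= subnn z0 mulw0r addr0.
apply: eq_bigr => k _; congr (mulw w _ _).
by apply: qserP => u; rewrite /ycomp /yscale /= subSn // -ltnS.
Qed.
End Scaling.

(** * Leading terms, cancellation and truncation *)

Section Cancel.
Context (F : fieldType) (q : F) (q_neq0 : q != 0).
Local Notation T := (qser q_neq0).
Implicit Types (f g h : T) (a b : bool) (u w : seq bool) (c : F).

Lemma mulw_lowl f h w : (forall u, (size u < size w)%N -> h u = 0) ->
  mulw w f h = f [::] * h w.
Proof.
elim: w f h => [|a w IH] f h h0 //=.
rewrite (IH (lder a f)) => [|u u_lt]; last by rewrite h0 // ltnS ltnW.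
rewrite h0 //= mulr0 add0r IH => [|u u_lt]; last exact: h0.
by rewrite /twist wpair_nil expr0z mul1r.
Qed.
Lemma mulw_lowr f h w : (forall u, (size u < size w)%N -> h u = 0) ->
  mulw w h f = h w * f [::].
Proof.
elim: w f h => [|a w IH] f h h0 //=.
rewrite IH => [|u u_lt]; last exact: h0.
rewrite (IH (lder a f)) => [|u u_lt].
  by rewrite /twist h0 //= mulr0 mul0r addr0.
by rewrite /twist h0 ?mulr0 // ltnS ltnW.
Qed.

(** A shortest word of [h] would survive in [f * h], multiplied by the constant term of [f].
    Cancellation replaces the use of inverse series. *)
Lemma qser_lcancel f h : f [::] != 0 -> f * h = 0 -> h = 0.
Proof.
move=> f0 fh; apply: qserP => w.
elim: {w}(size w) {-2}w (leqnn (size w)) => [|n IH] w le_w.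
  have /eqP := congr1 (fun g : T => g w) fh; rewrite qserM_mulw mulw_lowl ?mulf_eq0.
    by rewrite (negPf f0) => /eqP.
  by case: w le_w.
have /eqP := congr1 (fun g : T => g w) fh; rewrite qserM_mulw mulw_lowl ?mulf_eq0.
  by rewrite (negPf f0) => /eqP.
by move=> u u_lt; apply: IH; rewrite -ltnS (leq_trans u_lt).
Qed.
Lemma qser_rcancel f h : f [::] != 0 -> h * f = 0 -> h = 0.
Proof.
move=> f0 fh; apply: qserP => w.
elim: {w}(size w) {-2}w (leqnn (size w)) => [|n IH] w le_w.
  have /eqP := congr1 (fun g : T => g w) fh; rewrite qserM_mulw mulw_lowr ?mulf_eq0.
    by rewrite (negPf f0) orbF => /eqP.
  by case: w le_w.
have /eqP := congr1 (fun g : T => g w) fh; rewrite qserM_mulw mulw_lowr ?mulf_eq0.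
  by rewrite (negPf f0) orbF => /eqP.
by move=> u u_lt; apply: IH; rewrite -ltnS (leq_trans u_lt).
Qed.

Lemma mulw_eql f f' g w : (forall u, (size u <= size w)%N -> f u = f' u) ->
  mulw w f g = mulw w f' g.
Proof.
elim: w f f' g => [|a w IH] f f' g ff' /=; first by rewrite ff'.
rewrite (IH (lder a f) (lder a f')); last by move=> u u_le; apply: ff'.
rewrite (IH (twist a f) (twist a f')) // => u u_le.
by rewrite /twist ff' // (leq_trans u_le).
Qed.
Lemma mulw_eqr f g g' w : (forall u, (size u <= size w)%N -> g u = g' u) ->
  mulw w f g = mulw w f g'.
Proof.
elim: w f g g' => [|a w IH] f g g' gg' /=; first by rewrite gg'.
rewrite (IH _ (lder a g) (lder a g')); last by move=> u u_le; apply: gg'.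
by rewrite (IH (lder a f) g g') // => u u_le; rewrite gg' // (leq_trans u_le).
Qed.

Lemma sum_ycomp f n w : (ny w < n)%N -> (\sum_(k < n) ycomp k f) w = f w.
Proof.
move=> w_lt; rewrite qser_sum (bigD1 (Ordinal w_lt)) //= /ycomp {1}/yscale eqxx mul1r.
rewrite big1 ?addr0 // => k; rewrite -val_eqE /= eq_sym => /negPf nk.
by rewrite /yscale nk mul0r.
Qed.

(** A series is an infinite sum of its components, but a coefficient of a product at [w] only sees
    words no longer than [w], so a finite partial sum suffices. *)
Lemma ycomp_comm f z : (forall n, GRing.comm z (ycomp n f)) -> GRing.comm z f.
Proof.
move=> fz; apply: qserP => w; rewrite !qserM_mulw.
pose s : T := \sum_(k < (size w).+1) ycomp k f.
have fs u : (size u <= size w)%N -> f u = s u.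
  by move=> u_le; rewrite /s sum_ycomp // ltnS (leq_trans (count_size _ _)).
rewrite (mulw_eqr _ fs) (mulw_eql _ fs) -!qserM_mulw.
suff -> : z * s = s * z by [].
by rewrite mulr_sumr mulr_suml; apply: eq_bigr => k _; apply: fz.
Qed.
End Cancel.

(** * Logarithmic derivatives *)

Section Main.
Context (F : fieldType) (q : F) (q_neq0 : q != 0).
Hypothesis q2_neq1 : q ^+ 2 != 1.
Local Notation T := (qser q_neq0).
Local Notation "[ m ]" := (qnat q m).
Local Notation k := (q - q^-1).
Local Notation D := (walk0 q_neq0).
Local Notation Fw := (walk1 q_neq0).
Local Notation G := (altG q_neq0).
Local Notation W := (altW q_neq0).
Local Notation X := (letter q_neq0 true).
Local Notation Y := (letter q_neq0 false).
Local Notation P := (xwalk q_neq0).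
Local Notation XY := (wordxy q_neq0).
Implicit Types (f g h : T) (a b : bool) (u w : seq bool) (c : F).

Local Ltac field_q := field; do ?[apply/andP; split];
  rewrite ?q_neq0 ?(qqV_neq0 q_neq0 q2_neq1) ?(qq_neq1 q2_neq1) ?oner_neq0 //.

Lemma altG_comm r s : GRing.comm (G r) (G s).
Proof.
apply: qserP => w; apply/eqP; rewrite !qserM_mulw -subr_eq0.
by case: (altG_comm_pointwise q_neq0 r s w) => ->.
Qed.

Local Notation g := (G (geo (- q))).
Local Notation g' := (G (geo (- q^-1))).
Local Notation w := (W (geo (- q))).
Local Notation w' := (W (geo (- q^-1))).

Lemma walk0_0 : D 0 = 1.
Proof. by apply: qserP => -[|a u] //; rewrite /D /= qnat0 mul0r. Qed.

Lemma walk0_g m : q ^+ m.+1 *: (D m.+1 * g) = - (D m * w).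
Proof.
apply: qserP => u; apply/eqP; rewrite !qserE !qserM_mulw -addr_eq0.
by rewrite walk0_altG.
Qed.
Lemma walk0_1_g : D 1 * g = - q^-1 *: w.
Proof.
have /(congr1 (fun f => q^-1 *: f)) := walk0_g 0.
by rewrite scalerA expr1 mulVf // scale1r walk0_0 mul1r scalerN scaleNr.
Qed.
Lemma g'_walk0_1 : g' * D 1 = - q *: w'.
Proof.
apply: qserP => u; rewrite qserM_mulw qserZ.
have [/eqP] := altG_walk0 q_neq0 q2_neq1 1 u.
rewrite expr1 divff // subrr !(mul0r, mulr0) addr0 /= qnat1 // mulr1.
by rewrite walk0_0 mulw1l addr_eq0 => /eqP ->; rewrite mulNr.
Qed.
Lemma w'_walk0_1 : w' * D 1 = (q * [2]) *: (D 1 * w') + q ^+ 2 *: (D 2 * g').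
Proof.
apply: qserP => u; rewrite qserD !qserZ !qserM_mulw.
have [_ /eqP] := altG_walk0 q_neq0 q2_neq1 1 u.
by rewrite qnat1 // mulr1 expr1 muln1 -addrA -opprD subr_eq0 => /eqP.
Qed.

Lemma one_cons a u : (1 : T) (a :: u) = 0. Proof. by []. Qed.

Lemma w'g_comm : q ^+ 2 *: (w' * g) = g' * w.
Proof.
apply: qserP => -[|a u]; rewrite qserZ !qserM_mulw.
  by rewrite /= /W /= mul0r !mulr0.
rewrite !mulw_cons !lderE !twistE !altG_geoS !mulwE.
by case: a => /=; rewrite !mulwE; field_q.
Qed.

(** Both left derivatives of the left side vanish, the one by [x] thanks to [w'g_comm], so only its
    constant term remains. *)
Lemma g'g_letterx : g' * g + (q / k) *: (w' * X * g - g' * X * w) = 1.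
Proof.
apply: qserP => -[|a u].
  rewrite qserD qserZ qserB !(qserM_mulw, mulw_nil).
  by rewrite /letter /W /G /= /geo !expr0 !(mulr0, mul0r, subrr, addr0, mulr1).
rewrite !qserD qserZ qserB -!mulrA !qserM_mulw.
rewrite !mulw_cons !lderE !twistE !altG_geoS !mulwE.
have := congr1 (fun f : T => f u) w'g_comm; rewrite qserZ !qserM_mulw => E.
rewrite one_cons.
case: a => /=; rewrite -?scalerAl -?scalerAr ?mul1r !mulwE; last by field_q.
by rewrite -!E; field_q.
Qed.

Lemma walk1_eq : Fw 1 - 1 = k^-1 *: (q ^+ 2 *: (X * D 1) - D 1 * X).
Proof.
apply: qserP => u; rewrite !(qserZ, qserB) !qserM_mulw.
have /= := walk0_letterx q_neq0 q2_neq1 1 u.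
rewrite qnat1 // mul1r walk0_0 muln1 => /(congr1 (fun x => q ^+ 2 / k * x)).
rewrite mulr0 => /eqP e; apply/eqP; rewrite -subr_eq0 -(eqP e).
by apply/eqP; field_q.
Qed.

(** By [walk1_eq] every [D 1] stands next to [g] or [g'], where it is absorbed into [w] or [w']; the
    outcome is [g'g_letterx]. *)
Lemma g'_walk1_g : g' * Fw 1 * g = 1.
Proof.
rewrite -(subrK 1 (Fw 1)) walk1_eq mulrDr mulr1 mulrDl -[RHS]g'g_letterx addrC.
congr (_ + _); rewrite -scalerAr -scalerAl mulrBr mulrBl.
rewrite -scalerAr -scalerAl -!mulrA walk0_1_g [g' * (D 1 * _)]mulrA g'_walk0_1.
rewrite -!(scalerAr, scalerAl) scalerA !scalerBr !scalerA !mulrA addrC.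
by congr (_ + _); rewrite -?scaleNr; congr (_ *: _); field_q.
Qed.

Lemma yscale_altw (p s : nat -> F) b u :
  p (ny u) * altw b s u = altw b (fun n => p n * s n) u.
Proof.
elim: u b p s => [|a u IH] b p s /=; first by case: b; rewrite ?mulr0.
have [->|] := eqVneq a b; last by rewrite mulr0.
by case: b; rewrite /= ?add0n ?add1n ?IH // -(IH _ (p \o succn)).
Qed.
Lemma yscale_altG p s : yscale p (G s) = G (fun n => p n * s n).
Proof. by apply: qserP => u; apply: yscale_altw. Qed.
Lemma yscale_altW p s : yscale p (W s) = W (fun n => p n * s n).
Proof. by apply: qserP => u; apply: yscale_altw. Qed.
Lemma sigma_altG c d : sigma c (G (geo d)) = G (geo (c * d)).
Proof.
by rewrite /sigma yscale_altG; congr G; apply: boolp.funext => n; rewrite /geo exprMn.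
Qed.
Lemma sigma_altW c d : sigma c (W (geo d)) = W (geo (c * d)).
Proof.
by rewrite /sigma yscale_altW; congr W; apply: boolp.funext => n; rewrite /geo exprMn.
Qed.

Local Notation G1 := (G (geo (- 1))).
Local Notation W1 := (W (geo (- 1))).
Local Notation sq := (sigma q).
Local Notation sv := (sigma q^-1).

(** Rescaling moves the parameters [- q] and [- q^-1] to the common value -1, so that the relations
    for [g] and [g'] can be combined. *)
Lemma sigmaV_g : sv g = G1 /\ sv w = W1.
Proof. by rewrite sigma_altG sigma_altW mulrN mulVf. Qed.
Lemma sigma_g' : sq g' = G1 /\ sq w' = W1.
Proof. by rewrite sigma_altG sigma_altW mulrN mulfV. Qed.

Lemma sv_walk0_1 : sv (D 1) * G1 = - q^-1 *: W1.
Proof. by case: sigmaV_g => <- <-; rewrite -sigmaM walk0_1_g linearZ. Qed.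
Lemma sv_walk0_2 : sv (D 2) * G1 = - q ^- 2 *: (sv (D 1) * W1).
Proof.
case: sigmaV_g => <- <-; rewrite -!sigmaM -linearZ /=; congr (sv _).
have /(congr1 (fun f => q ^- 2 *: f)) := walk0_g 1.
by rewrite scalerA mulVf ?expf_neq0 // scale1r scalerN scaleNr.
Qed.
Lemma G1_sq_walk0_1 : G1 * sq (D 1) = - q *: W1.
Proof. by case: sigma_g' => <- <-; rewrite -sigmaM g'_walk0_1 linearZ. Qed.
Lemma W1_sq_walk0_1 : W1 * sq (D 1) = (q * [2]) *: (sq (D 1) * W1) + q ^+ 2 *: (sq (D 2) * G1).
Proof. by case: sigma_g' => <- <-; rewrite -!sigmaM w'_walk0_1 linearD !linearZ. Qed.

(* Up to scalars both sides equal [sv (D 1) * W1]: replace [W1] by [G1 * sq (D 1)] on one side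
   and by [sv (D 1) * G1] on the other. *)
Lemma sigma_walk0_balance :
  sq (D 2) * G1 + (1 + q ^- 2) *: (sq (D 1) * W1)
  = sv (D 2) * G1 + (1 + q ^- 2) *: (sv (D 1) * W1).
Proof.
rewrite sv_walk0_2 -scalerDl [- _ + _]addrC addrK scale1r.
have e : W1 * sq (D 1) = q ^+ 2 *: (sv (D 1) * W1).
  have -> : sv (D 1) * W1 = - q^-1 *: (sv (D 1) * (G1 * sq (D 1))).
    rewrite G1_sq_walk0_1 -scalerAr scalerA.
    by rewrite mulrNN mulVf // scale1r.
  rewrite mulrA sv_walk0_1 -scalerAl !scalerA.
  suff -> : q ^+ 2 * - q^-1 * - q^-1 = 1 by rewrite scale1r.
  by field_q.
apply: (scalerI (expf_neq0 2 q_neq0)).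
rewrite -e W1_sq_walk0_1 scalerDr addrC scalerA; congr (_ *: _ + _).
by rewrite /qnat; field_q.
Qed.

(** In degree [n] this is [[n]] times the component of [P], as the two rescalings contribute
    [q ^+ n - q ^- n]. *)
Definition Psi : T := k^-1 *: (sq P - sv P).

Lemma lder_Psi a : lder a Psi = if a then k^-1 *: (sq (D 1) - sv (D 1)) else 0.
Proof.
rewrite -[LHS]/(k^-1 *: (lder a (sq P) - lder a (sv P))) !lder_sigma !lder_xwalk.
by case: a; rewrite ?scale1r // !linear0 addr0 scaler0.
Qed.
Lemma twist_Psi a : twist a Psi = Psi.
Proof.
rewrite /Psi -[- sv P]scaleN1r twistZ twistD twistZ.
by rewrite /sigma !twist_yscale !twist_xwalk.
Qed.
Lemma lder_sq_walk0_1 a : lder a (sq (D 1)) = if a then sq (D 2) else q *: 1.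
Proof.
rewrite lder_sigma lder_walk0 qnat1 // scale1r; case: a => //=; first by rewrite scale1r.
by rewrite walk0_0; congr (_ *: _); apply: qserP => -[|b u]; rewrite /sigma /yscale ?mul1r ?mulr0.
Qed.
Lemma lder_sv_walk0_1 a : lder a (sv (D 1)) = if a then sv (D 2) else q^-1 *: 1.
Proof.
rewrite lder_sigma lder_walk0 qnat1 // scale1r; case: a => //=; first by rewrite scale1r.
by rewrite walk0_0; congr (_ *: _); apply: qserP => -[|b u]; rewrite /sigma /yscale ?mul1r ?mulr0.
Qed.
Lemma twist_sigma_walk0_1 a c :
  twist a (sigma c (D 1)) = (if a then q ^- 2 else q ^+ 2) *: sigma c (D 1).
Proof. by rewrite twist_sigma twist_walk0 muln1 linearZ. Qed.

(* The second component is the [x]-derivative of the first. *)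
Lemma theta_G1_pointwise u :
  (ny u)%:R * G1 u + mulw u Psi G1 = 0 /\
  (ny u)%:R * W1 u + k^-1 * (mulw u (sq (D 1)) G1 - mulw u (sv (D 1)) G1)
    + mulw u Psi W1 = 0.
Proof.
elim: u => [|a u [IH1 IH2]].
  by rewrite !mulw_nil /Psi /W /sigma /yscale !qserE /D /= !(mulr0, mul0r, mulr0n, addr0, subrr).
rewrite !mulw_cons !(lder_Psi, lder_sq_walk0_1, lder_sv_walk0_1, lder_altG, lder_altW).
rewrite !(twist_Psi, twist_sigma_walk0_1, twist_altG, twist_altW) altG_geoS !mulwE.
rewrite -[G1 (a :: u)]/(lder a G1 u) -[W1 (a :: u)]/(lder a W1 u) lder_altG lder_altW altG_geoS.
(* This settles the [x]-derivative of the second component, which is [k^-1] times the difference of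
   the two sides of the balance. *)
have B := congr1 (fun f : T => f u) sigma_walk0_balance.
rewrite !qserD !qserZ !qserM_mulw in B.
have N f1 f2 : mulw u (- f1) f2 = - mulw u f1 f2.
  by rewrite -scaleN1r mulwZl mulN1r.
have PsiE f : mulw u Psi f = k^-1 * (mulw u (sq P) f - mulw u (sv P) f).
  by rewrite mulwZl mulwDl N.
rewrite !PsiE in IH1 IH2.
case: a => /=; rewrite ?add0n ?add1n ?mulwE ?N; split.
- by rewrite -[RHS]IH2; ring.
- move/eqP: B; rewrite -subr_eq0 => /eqP B.
  by apply: (lincomb1 B (c := k^-1)); field_q.
- by rewrite !(addr0, mulr0).
- by apply: (lincomb1 IH1 (c := -1)); rewrite -natr1 qserZ; field_q.
Qed.
Lemma theta_G1 : theta G1 = - (Psi * G1).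
Proof.
apply: qserP => u; apply/eqP; rewrite qserN qserM_mulw -addr_eq0.
by case: (theta_G1_pointwise u) => <-.
Qed.
End Main.

(** * Commutation and recurrences for the homogeneous components *)

Section LogDerivative.
Context (F : fieldType) (q : F) (q_neq0 : q != 0).
Hypothesis q_nroot : forall n : nat, (0 < n)%N -> q ^+ n != 1.
Local Notation T := (qser q_neq0).
Local Notation "[ m ]" := (qnat q m).
Local Notation k := (q - q^-1).
Local Notation Fw := (walk1 q_neq0).
Local Notation G := (altG q_neq0).
Local Notation P := (xwalk q_neq0).
Local Notation Psi := (Psi q_neq0).
Implicit Types (f h z : T) (a b : bool) (u w : seq bool) (c : F).
Let q2_neq1 : q ^+ 2 != 1. Proof. exact: q_nroot. Qed.

Lemma qnat_neq0 n : (0 < n)%N -> [n] != 0.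
Proof.
move=> n_gt0; rewrite /qnat mulf_neq0 ?invr_neq0 ?qqV_neq0 ?expf_neq0 //.
by rewrite -exprM q_nroot // muln_gt0 n_gt0.
Qed.

Lemma ycomp_Psi n : ycomp n Psi = [n] *: ycomp n P.
Proof.
apply: qserP => u; rewrite qserZ /ycomp /Psi /sigma /yscale qserZ qserB.
have [->|_] := eqVneq (ny u) n; last by rewrite !mul0r mulr0.
by rewrite /qnat exprVn; ring.
Qed.

Lemma ycomp_theta n f : ycomp n (theta f) = n%:R *: ycomp n f.
Proof.
apply: qserP => u; rewrite qserZ /ycomp /theta /yscale.
by have [->|_] := eqVneq (ny u) n; rewrite ?mul1r // !mul0r mulr0.
Qed.

Lemma ycomp_sigma n c f : ycomp n (sigma c f) = c ^+ n *: ycomp n f.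
Proof.
apply: qserP => u; rewrite qserZ /ycomp /sigma /yscale.
by have [->|_] := eqVneq (ny u) n; rewrite ?mul1r // !mul0r mulr0.
Qed.

Local Notation G1 := (G (geo (- 1))).

Lemma geo0 c : geo c 0 = 1. Proof. by []. Qed.

Lemma ycomp0_altG s : ycomp 0 (G s) = s 0%N *: 1.
Proof.
apply: qserP => u; rewrite qserZ /ycomp /yscale.
by case: u => [|[] [|[] u]] //=; rewrite ?mulr0 ?mulr1 ?mul1r //= mulr0n mul0r.
Qed.

Lemma altG_recurrence n : n%:R *: ycomp n G1
  = - \sum_(j < n.+1) [j] *: (ycomp j P * ycomp (n - j)%N G1).
Proof.
rewrite -ycomp_theta theta_G1 // linearN /= ycompM; congr (- _).
by apply: eq_bigr => j _; rewrite ycomp_Psi scalerAl.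
Qed.

Lemma commrZ c z f : GRing.comm z f -> GRing.comm z (c *: f).
Proof. by move=> zf; rewrite /GRing.comm -scalerAr zf scalerAl. Qed.

(* By [altG_recurrence] the components of [P] are polynomials in those of [G1]. *)
Lemma commr_ycomp_xwalk z : (forall s, GRing.comm z (G s)) ->
  forall n, (0 < n)%N -> GRing.comm z (ycomp n P).
Proof.
move=> zG n; have zGn m : GRing.comm z (ycomp m G1) by rewrite /ycomp yscale_altG.
elim/ltn_ind: n => n IH n_gt0.
(* The top term of the sum is [[n] *: ycomp n P], since [G1] has constant component 1; it is
   isolated and divided by [[n]], nonzero as [q] is not a root of unity. *)
have := altG_recurrence n; rewrite big_ord_recr /= subnn ycomp0_altG geo0 scale1r mulr1.
move/eqP; rewrite eq_sym eqr_oppLR addrC eq_sym -subr_eq => /eqP e.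
have -> : ycomp n P = [n]^-1 *: ([n] *: ycomp n P).
  by rewrite scalerA mulVf ?qnat_neq0 // scale1r.
rewrite -{}e; apply: commrZ; apply: commrB.
  by apply: commrN; apply: commrZ.
apply: commr_sum => -[j j_lt] _ /=.
case: j j_lt => [|j] j_lt; first by rewrite qnat0 scale0r; apply: commr0.
by apply/commrZ/commrM => //; apply: IH.
Qed.

Lemma ycomp_xwalk_comm_altG n s : (0 < n)%N -> GRing.comm (ycomp n P) (G s).
Proof.
by move=> n_gt0; apply/commr_sym/commr_ycomp_xwalk => // r; apply: altG_comm.
Qed.
Lemma ycomp_xwalk_comm m n : (0 < m)%N -> (0 < n)%N ->
  GRing.comm (ycomp m P) (ycomp n P).
Proof. by move=> m0 n0; apply: commr_ycomp_xwalk => // s; apply: ycomp_xwalk_comm_altG. Qed.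

Local Notation g := (G (geo (- q))).
Local Notation g' := (G (geo (- q^-1))).

(** Sandwiched between [g'] and [g], both products reduce to [z] by [g'_walk1_g]; then the outer
    factors are cancelled. *)
Lemma commr_walk1 z : (forall s, GRing.comm z (G s)) -> GRing.comm z (Fw 1).
Proof.
move=> zG; apply/eqP; rewrite -subr_eq0; apply/eqP.
apply: (@qser_lcancel _ _ _ g'); first by rewrite /G /= /geo expr0 oner_neq0.
apply: (@qser_rcancel _ _ _ g); first by rewrite /G /= /geo expr0 oner_neq0.
rewrite mulrBr mulrBl; apply/eqP; rewrite subr_eq0; apply/eqP.
rewrite mulrA -(zG (geo (- q^-1))) -!mulrA (mulrA g') g'_walk1_g // mulr1.
by rewrite (zG (geo (- q))) !mulrA g'_walk1_g // mul1r.
Qed.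

Lemma Psi_comm z : (forall n, (0 < n)%N -> GRing.comm z (ycomp n P)) ->
  forall c, GRing.comm z (sigma c Psi).
Proof.
move=> zP c; apply: ycomp_comm => -[|n]; rewrite ycomp_sigma ycomp_Psi.
  by rewrite qnat0 scale0r scaler0; apply: commr0.
by apply/commrZ/commrZ/zP.
Qed.
Lemma Psi_comm_altG c s : GRing.comm (sigma c Psi) (G s).
Proof. by apply/commr_sym/Psi_comm => n n0; apply/commr_sym/ycomp_xwalk_comm_altG. Qed.
Lemma Psi_comm_walk1 c : GRing.comm (sigma c Psi) (Fw 1).
Proof. by apply: commr_walk1 => s; apply: Psi_comm_altG. Qed.

Lemma theta_sigma c f : theta (sigma c f) = sigma c (theta f).
Proof. by apply: qserP => u; rewrite /theta /sigma /yscale mulrCA. Qed.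

Lemma theta_g : theta g = - (sigma q Psi * g).
Proof.
have -> : g = sigma q G1 by rewrite sigma_altG mulrN mulr1.
by rewrite theta_sigma theta_G1 // linearN /= sigmaM.
Qed.
Lemma theta_g' : theta g' = - (sigma q^-1 Psi * g').
Proof.
have -> : g' = sigma q^-1 G1 by rewrite sigma_altG mulrN mulr1.
by rewrite theta_sigma theta_G1 // linearN /= sigmaM.
Qed.

(** Apply the derivation [theta] to [g' * Fw 1 * g = 1], gather the [Psi] factors next to [Fw 1] by
    commutation, and cancel [g'] and [g]. *)
Lemma theta_walk1 : theta (Fw 1) = (sigma q Psi + sigma q^-1 Psi) * Fw 1.
Proof.
apply/eqP; rewrite -subr_eq0; apply/eqP.
apply: (@qser_lcancel _ _ _ g'); first by rewrite /G /= /geo expr0 oner_neq0.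
apply: (@qser_rcancel _ _ _ g); first by rewrite /G /= /geo expr0 oner_neq0.
have : theta (g' * Fw 1 * g) = 0.
  rewrite g'_walk1_g //; apply: qserP => -[|a u]; rewrite /theta /yscale /= ?mulr0 //.
  by rewrite mulr0n mul0r.
have e1 : sigma q^-1 Psi * g' * Fw 1 * g = g' * (sigma q^-1 Psi * Fw 1) * g.
  by rewrite Psi_comm_altG !mulrA.
have e2 : g' * Fw 1 * (sigma q Psi * g) = g' * (sigma q Psi * Fw 1) * g.
  by rewrite Psi_comm_walk1 !mulrA.
rewrite !thetaM theta_g theta_g' mulrDl !mulNr mulrN e1 e2 => <-.
rewrite mulrBr mulrBl (mulrDl _ _ (Fw 1)) mulrDr mulrDl opprD.
by rewrite addrA addrAC [X in _ = X + _]addrC.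
Qed.

Lemma walk1_recurrence n : n%:R *: ycomp n (Fw 1)
  = \sum_(j < n.+1) [2 * j] *: (ycomp j P * ycomp (n - j)%N (Fw 1)).
Proof.
rewrite -ycomp_theta theta_walk1 ycompM; apply: eq_bigr => j _.
rewrite linearD /= !ycomp_sigma !ycomp_Psi -scalerDl scalerA scalerAl; congr (_ *: _ * _).
(* The coefficients combine by [[j] (q^j + q^-j) = [2 j]]. *)
rewrite /qnat mul2n -addnn exprD exprVn.
have : q ^+ j != 0 by apply: expf_neq0.
move: (q ^+ j) => Q Q0; field; by rewrite Q0 q_neq0 qq_neq1.
Qed.

Lemma ycomp0_walk1 : ycomp 0 (Fw 1) = 1.
Proof.
have e : ycomp 0 (g' * Fw 1 * g) = ycomp 0 (1 : T) by rewrite g'_walk1_g.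
move: e; rewrite !ycompM !big_ord1 /= !subnn ycompM big_ord1 !ycomp0_altG.
rewrite !geo0 !scale1r mul1r mulr1 => ->.
by apply: qserP => -[|a u]; rewrite /ycomp /yscale /= ?mul1r ?mulr0.
Qed.
End LogDerivative.

(** * Exponentials of commuting coefficients *)

Section ExpSeries.
Context (F : fieldType) (T : algType F).
Hypothesis F_char0 : [pchar F] =i pred0.
Implicit Types (p : nat -> T).

Lemma natF_neq0 n : (n.+1)%:R != 0 :> F.
Proof. by have /pcharf0P -> := F_char0. Qed.

Lemma commr_poly (f h : {poly T}) :
  (forall i j, GRing.comm f`_i h`_j) -> GRing.comm f h.
Proof.
move=> fh; apply/polyP => i; rewrite coefM coefMr.
by apply: eq_bigr => j _; apply: fh.
Qed.

Lemma deriv_exp_comm (f : {poly T}) m : GRing.comm f f^`() ->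
  (f ^+ m.+1)^`() = f^`() * f ^+ m *+ m.+1.
Proof.
move=> ff; elim: m => [|m IH]; first by rewrite expr1 expr0 mulr1.
by rewrite exprS derivM IH mulrnAr mulrA ff -mulrA -exprS -mulrS.
Qed.

(** Below degree [N] a power of the series agrees with that of its truncation, which makes the
    derivative of polynomials available. *)
Lemma pcoef_poly p N m n : (n < N)%N ->
  pcoef p m n = ((\poly_(i < N) p i) ^+ m)`_n.
Proof.
elim: m n => [|m IH] n n_lt /=; first by rewrite expr0 coef1.
rewrite exprS coefM; apply: eq_bigr => j _.
rewrite coef_poly (leq_ltn_trans (leq_ord j) n_lt) IH //.
by rewrite (leq_ltn_trans (leq_subr _ _)).
Qed.

Lemma pcoef_eq0 p m n : p 0%N = 0 -> (n < m)%N -> pcoef p m n = 0.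
Proof.
move=> p0; elim: m n => [|m IH] n //= n_lt.
rewrite big1 // => -[[|j] j_lt] _ /=; first by rewrite p0 mul0r.
rewrite IH ?mulr0 //; case: n n_lt j_lt => [|n] // n_lt j_lt.
by rewrite subSS (leq_ltn_trans (leq_subr _ _)).
Qed.

(** A bound independent of the degree allows the double sum in [expcoef_recurrence] to be
    exchanged. *)
Lemma expcoef_widen p n N : p 0%N = 0 -> (n < N)%N ->
  expcoef p n = \sum_(m < N) (m`!%:R : F)^-1 *: pcoef p m n.
Proof.
move=> p0 n_lt; rewrite /expcoef (big_ord_widen N (fun m => (m`!%:R : F)^-1 *: pcoef p m n)) //.
rewrite big_mkcond; apply: eq_bigr => m _; case: ifP => // /negbT.
by rewrite -leqNgt => m_gt; rewrite pcoef_eq0 // scaler0.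
Qed.

Lemma pcoef_recurrence p m n : (forall i j, GRing.comm (p i) (p j)) ->
  pcoef p m.+1 n.+1 *+ n.+1
  = (\sum_(j < n.+1) p j.+1 *+ j.+1 * pcoef p m (n - j)) *+ m.+1.
Proof.
move=> pC; set f := \poly_(i < n.+2) p i.
have fE i j : GRing.comm f`_i f`_j.
  rewrite !coef_poly; case: ifP => _; last exact/commr_sym/commr0.
  by case: ifP => _; [apply: pC|apply: commr0].
have ff' : GRing.comm f f^`().
  by apply: commr_poly => i j; rewrite coef_deriv; apply: commrMn.
rewrite (@pcoef_poly p n.+2) // -coef_deriv deriv_exp_comm // coefMn.
congr (_ *+ _); rewrite coefM; apply: eq_bigr => j _.
rewrite coef_deriv coef_poly ltnS ltn_ord; congr (_ * _).
by rewrite (@pcoef_poly p n.+2) // ltnS (leq_trans (leq_subr _ _)).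
Qed.

(** This is [(exp p)' = p' exp p] coefficientwise, which relies on the coefficients of [p]
    commuting. *)
Lemma expcoef_recurrence p n : p 0%N = 0 -> (forall i j, GRing.comm (p i) (p j)) ->
  n.+1%:R *: expcoef p n.+1
  = \sum_(j < n.+1) j.+1%:R *: (p j.+1 * expcoef p (n - j)).
Proof.
move=> p0 pC; rewrite {1}/expcoef big_ord_recl /= scaler0 add0r scaler_sumr.
rewrite (eq_bigr (fun m : 'I_n.+1 => \sum_(j < n.+1)
    (m`!%:R : F)^-1 *: (p j.+1 *+ j.+1 * pcoef p m (n - j)))) => [|m _].
  rewrite exchange_big; apply: eq_bigr => j _ /=.
  rewrite (@expcoef_widen _ _ n.+1) ?ltnS ?leq_subr // mulr_sumr scaler_sumr.
  apply: eq_bigr => m _; rewrite -scalerAr scalerA mulrC -scalerA scaler_nat.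
  by rewrite mulrnAl.
rewrite /bump /= add1n -scaler_sumr scalerA mulrC -scalerA scaler_nat.
rewrite -[X in _ *: (X *+ _)]/(pcoef p m.+1 n.+1) pcoef_recurrence //.
rewrite -scaler_nat scalerA factS natrM invfM mulrAC mulVf ?mul1r //.
exact: natF_neq0.
Qed.

Lemma expcoef0 p : expcoef p 0 = 1.
Proof. by rewrite /expcoef big_ord1 /= fact0 invr1 scale1r. Qed.

(** The equation [c' = p' c] determines [c] from its constant term, since characteristic zero
    permits division by [n.+1]. *)
Lemma eq_expcoef (c : nat -> T) p : p 0%N = 0 ->
  (forall i j, GRing.comm (p i) (p j)) -> c 0%N = 1 ->
  (forall n, n.+1%:R *: c n.+1
     = \sum_(j < n.+1) j.+1%:R *: (p j.+1 * c (n - j)%N)) ->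
  forall n, expcoef p n = c n.
Proof.
move=> p0 pC c0 cS n; elim/ltn_ind: n => -[|n] IH; first by rewrite expcoef0.
apply: (scalerI (natF_neq0 n)); rewrite expcoef_recurrence // cS.
by apply: eq_bigr => j _; rewrite IH // ltnS leq_subr.
Qed.

Lemma eq_pcoef p p' m n : (forall i, (i <= n)%N -> p i = p' i) ->
  pcoef p m n = pcoef p' m n.
Proof.
elim: m n => [|m IH] n pp' //=; apply: eq_bigr => j _.
rewrite pp' ?leq_ord // (IH (n - j)%N) // => i i_le.
by rewrite pp' // (leq_trans i_le) ?leq_subr.
Qed.

Lemma pcoef1 p n : pcoef p 1 n = p n.
Proof.
rewrite /= big_ord_recr /= subnn mulr1 big1 ?add0r // => j _.
by rewrite subn_eq0 leqNgt ltn_ord mulr0.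
Qed.

Lemma expcoefS p n : expcoef p n.+1
  = p n.+1 + \sum_(m < n) (m.+2`!%:R : F)^-1 *: pcoef p m.+2 n.+1.
Proof.
rewrite /expcoef big_ord_recl big_ord_recl.
by rewrite -[pcoef p 0 _]/0 scaler0 add0r pcoef1 invr1 scale1r.
Qed.

(** In a power of exponent at least 2, the coefficient [p n.+1] only meets the constant term of the
    remaining power, which is zero. *)
Lemma eq_pcoef2 p p' m n : p 0%N = 0 -> p' 0%N = 0 ->
  (forall i, (i <= n)%N -> p i = p' i) -> pcoef p m.+2 n.+1 = pcoef p' m.+2 n.+1.
Proof.
move=> p0 p'0 pp'; rewrite -/(pcoef p m.+2 n.+1).
have step r : pcoef r m.+2 n.+1 = \sum_(j < n.+2) r j * pcoef r m.+1 (n.+1 - j) by [].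
rewrite !step; apply: eq_bigr => -[[|j] j_lt] _.
  by rewrite [nat_of_ord _]/= p0 p'0 !mul0r.
rewrite [nat_of_ord _]/= subSS; move: j_lt; rewrite ltnS leq_eqVlt eqSS => /orP[/eqP ->|j_lt].
  by rewrite subnn !pcoef_eq0 // !mulr0.
rewrite pp' //; congr (_ * _); apply: eq_pcoef => i i_le.
by rewrite pp' // (leq_trans i_le) ?leq_subr.
Qed.

(** In degree [n.+1] the exponential is [p n.+1] plus terms in lower coefficients. The argument is
    valid for noncommuting coefficients, as the Beck sequence, given only through its exponential,
    requires. *)
Lemma expcoef_inj p p' : p 0%N = 0 -> p' 0%N = 0 ->
  (forall n, (0 < n)%N -> expcoef p n = expcoef p' n) ->
  forall n, p n = p' n.
Proof.
move=> p0 p'0 ee n; elim/ltn_ind: n => -[|n] IH; first by rewrite p0.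
have := ee n.+1 isT; rewrite !expcoefS.
under eq_bigr => m _ do rewrite (@eq_pcoef2 p p' m n) //.
exact: addIr.
Qed.
End ExpSeries.

(** * Comparison with the free algebra *)

Section Coefficients.
Context (F : fieldType) (q : F) (q_neq0 : q != 0).
Local Notation T := (qser q_neq0).
Local Notation Fw := (walk1 q_neq0).
Local Notation D := (walk0 q_neq0).
Local Notation P := (xwalk q_neq0).
Implicit Types (f g : Vfree F) (a b : bool) (u v w : seq bool) (c : F).

Definition coefw f : T := fun w => f@_(FMonom w).

Fact coefw_is_linear : linear coefw.
Proof. by move=> c f g; apply: qserP => w; rewrite !qserE /coefw mcoeffD mcoeffZ. Qed.
HB.instance Definition _ :=
  GRing.isLinear.Build F (Vfree F) T _ coefw coefw_is_linear.

Lemma coefw_inj : injective coefw.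
Proof. by move=> f g fg; apply/malgP => -[w]; exact: (congr1 (fun h : T => h w) fg). Qed.

Lemma coefw_wrd u w : coefw (wrd F u) w = (u == w)%:R.
Proof. by rewrite /coefw /wrd mcoeffU1. Qed.

Lemma coefw_U c u w : coefw << c *g FMonom u >> w = c * (u == w)%:R.
Proof. by rewrite /coefw mcoeffU mulr_natr. Qed.

Lemma coefwE f w : coefw f w = \sum_(u <- msupp f) f@_u * (val u == w)%:R.
Proof.
rewrite {1}[f]monalgE linear_sum /=.
elim/big_rec2: _ => // -[u] x h _ <-.
by rewrite qserD coefw_U.
Qed.

Lemma wrd_expand f : f = \sum_(u <- msupp f) f@_u *: wrd F u.
Proof.
rewrite {1}[f]monalgE; apply: eq_bigr => u _.
by apply/malgP => v; rewrite mcoeffZ !mcoeffU fmK mulr_natr.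
Qed.

Lemma wrd_mulU a c u :
  wrd F [:: a] * << c *g FMonom u >> = << c *g FMonom (a :: u) >>.
Proof.
rewrite malgM_def fgmulUU mul1r; congr (<< _ *g _ >>).
by apply/eqP; rewrite fmP fmM.
Qed.
Lemma mulU_wrd a c u :
  << c *g FMonom u >> * wrd F [:: a] = << c *g FMonom (rcons u a) >>.
Proof.
rewrite malgM_def fgmulUU mulr1; congr (<< _ *g _ >>).
by apply/eqP; rewrite fmP fmM -cats1.
Qed.

Lemma coefw_letterM a b f w : coefw (wrd F [:: a] * f) (b :: w) = (a == b)%:R * coefw f w.
Proof.
rewrite {1}[f]monalgE mulr_sumr linear_sum /= coefwE mulr_sumr.
elim/big_rec2: _ => // -[u] x h _ <-.
rewrite qserD wrd_mulU coefw_U eqseq_cons.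
by rewrite mulrCA; congr (_ * _ + _); case: (a == b); rewrite ?mul0r ?mul1r.
Qed.
Lemma coefw_letterM0 a f : coefw (wrd F [:: a] * f) [::] = 0.
Proof.
rewrite [f]monalgE mulr_sumr linear_sum /=.
elim/big_rec: _ => // -[u] x _ e.
by rewrite qserD wrd_mulU coefw_U mulr0 e addr0.
Qed.
Lemma coefw_Mletter a b f w : coefw (f * wrd F [:: a]) (rcons w b) = (a == b)%:R * coefw f w.
Proof.
rewrite {1}[f]monalgE mulr_suml linear_sum /= coefwE mulr_sumr.
elim/big_rec2: _ => // -[u] x h _ <-.
rewrite qserD mulU_wrd coefw_U eqseq_rcons andbC.
by rewrite mulrCA; congr (_ * _ + _); case: (a == b); rewrite ?mul0r ?mul1r.
Qed.
Lemma coefw_Mletter0 a f : coefw (f * wrd F [:: a]) [::] = 0.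
Proof.
rewrite [f]monalgE mulr_suml linear_sum /=.
elim/big_rec: _ => // -[u] x _ e.
by rewrite qserD mulU_wrd coefw_U e addr0; case: u => *; rewrite mulr0.
Qed.

Lemma coefw_wrd0 : coefw (wrd F [::]) = 1.
Proof. by apply: qserP => w; rewrite coefw_wrd eq_sym. Qed.
Lemma lder_wrd a b u : lder b (coefw (wrd F (a :: u))) = (a == b)%:R *: coefw (wrd F u).
Proof.
apply: qserP => w; rewrite qserZ /lder !coefw_wrd eqseq_cons.
by case: (a == b); rewrite ?mul0r ?mul1r.
Qed.
Lemma twist_wrd b u : twist b (coefw (wrd F u)) = q ^ wpair u b *: coefw (wrd F u).
Proof.
apply: qserP => w; rewrite qserZ /twist coefw_wrd.
by have [->|_] := eqVneq u w; rewrite ?mulr0.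
Qed.

Lemma coefwDZ c f g w : coefw (f + c *: g) w = coefw f w + c * coefw g w.
Proof. by rewrite /coefw mcoeffD mcoeffZ. Qed.

Lemma coefw_shw_nil a u b v : coefw (shw q (a :: u) (b :: v)) [::] = 0.
Proof.
set c := q ^ wpair (a :: u) b.
transitivity (0 + c * 0); last by rewrite mulr0 addr0.
apply: etrans (coefwDZ c _ _ [::]) _.
by apply: (congr2 (fun x y => x + c * y)); apply: coefw_letterM0.
Qed.
Lemma coefw_shw_cons a u b v d w : coefw (shw q (a :: u) (b :: v)) (d :: w)
  = (a == d)%:R * coefw (shw q u (b :: v)) w
    + q ^ wpair (a :: u) b * ((b == d)%:R * coefw (shw q (a :: u) v) w).
Proof.
set c := q ^ wpair (a :: u) b.
apply: etrans (coefwDZ c _ _ (d :: w)) _.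
by apply: (congr2 (fun x y => x + c * y)); apply: coefw_letterM.
Qed.

Lemma mulw_cons_eigen (f f' g g' : T) c c1 c2 a w :
  lder a (f : T) = c1 *: f' -> lder a g = c2 *: g' -> twist a f = c *: f ->
  mulw (a :: w) f g = c1 * mulw w f' g + c * (c2 * mulw w f g') :> F.
Proof. by rewrite mulw_cons => -> -> ->; rewrite !mulwZl mulwZr. Qed.

(** The recursion of [shw] on first letters is the Leibniz rule defining [mulw]. *)
Lemma coefw_shw u v : coefw (shw q u v) = coefw (wrd F u) * coefw (wrd F v).
Proof.
elim: u v => [|a u IHu] v; first by rewrite coefw_wrd0 mul1r.
elim: v => [|b v IHv]; first by rewrite coefw_wrd0 mulr1.
apply: qserP => -[|d w].
  by rewrite coefw_shw_nil qserM_mulw mulw_nil [X in X * _]coefw_wrd [_ == _]/= mulr0n mul0r.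
rewrite coefw_shw_cons IHu IHv.
rewrite [RHS](mulw_cons_eigen _ (lder_wrd a d u) (lder_wrd b d v) (twist_wrd d _)).
(* The powers of [q] pair [a :: u] with [b] on one side and with [d] on the other; where these
   differ, the factor [b == d] is zero. *)
by have [->|_] := eqVneq b d; rewrite ?mul0r ?mulr0.
Qed.

Lemma coefw_expand f : coefw f = \sum_(u <- msupp f) f@_u *: coefw (wrd F u).
Proof.
by rewrite {1}[f]wrd_expand linear_sum /=; apply: eq_bigr => u _; rewrite linearZ.
Qed.

Lemma coefw_qstar f g : coefw (qstar q f g) = coefw f * coefw g.
Proof.
rewrite [coefw f]coefw_expand [coefw g]coefw_expand mulr_suml linear_sum /=.
apply: eq_bigr => u _; rewrite mulr_sumr linear_sum /=; apply: eq_bigr => v _.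
by rewrite linearZ /= coefw_shw -scalerAl -scalerAr scalerA.
Qed.

Lemma qintE (m : nat) : qint q m = qnat q m.
Proof. by rewrite /qint /qnat exprnN. Qed.

Lemma walk1_prod m w : Fw m w = (m%:Z + psum w == 1)%:R
  * \prod_(i < size w) qint q (m%:Z + psum (take i w)).
Proof.
elim: w m => [|a w IH] m.
  by rewrite big_ord0 psum_nil addr0 mulr1.
rewrite [Fw m _]walk_cons -/(Fw _) big_ord_recl /= psum_nil addr0 qintE mulrCA.
have [-> /=|m0] := eqVneq m 0%N; first by rewrite qnat0 !mul0r.
rewrite IH; congr (_ * _).
have e : (if a then m.+1 else m.-1)%:Z = m%:Z + lbar a.
  case: a => /=; first by rewrite -addn1 PoszD.
  by case: m m0 => // m _; rewrite -[in RHS](addn1 m) PoszD addrK.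
rewrite e psum_cons addrA; congr (_ * _).
by apply: eq_bigr => i _; rewrite /= psum_cons addrA.
Qed.

(** A step from height 0 has weight [[0] = 0], and the walk ends at height 1. Heights being partial
    sums shifted by one, this is the Catalan condition. *)
Lemma walk1_pos m w : Fw m w != 0 ->
  forall i, (i <= size w)%N -> 1 <= m%:Z + psum (take i w).
Proof.
elim: w m => [|a w IH] m.
  rewrite /Fw /=; have [->|] := eqVneq m 1%N; last by rewrite eqxx.
  by move=> _ [|i] //; rewrite psum_nil.
rewrite [Fw m _]walk_cons -/(Fw _) mulf_eq0 negb_or => /andP[m0 /IH {}IH] [|i] i_le.
  by rewrite take0 psum_nil addr0; case: m m0 {IH} => //; rewrite qnat0 eqxx.
have := IH i i_le; rewrite /= psum_cons.
case: a {IH i_le} => /=; first by rewrite -(addn1 m) PoszD -addrA.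
case: m m0 => [|m]; first by rewrite qnat0 eqxx.
move=> _ /=.
by rewrite -(addn1 m) PoszD addrA addrK.
Qed.

Lemma psum_size w : psum w = (size w)%:Z - (2 * ny w)%N%:Z.
Proof.
elim: w => [|a w IH]; first by rewrite psum_nil.
rewrite psum_cons IH /=; case: a => /=.
  by rewrite add0n -addn1 PoszD; ring.
by rewrite mulnDr muln1 -addn1 !PoszD; ring.
Qed.

Hypothesis q2_neq1 : q ^+ 2 != 1.

Lemma coefw_Ccat n : coefw (Ccat q n) = ycomp n (Fw 1).
Proof.
apply: qserP => w; rewrite /Ccat linear_sum /=.
transitivity (\sum_(t : (2 * n).-tuple bool | catalan t)
   (\prod_(i < (2 * n).+1) qint q (1 + psum (take i t))) * (val t == w)%:R).
  elim/big_rec2: _ => // t x h _ <-.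
  by rewrite qserD linearZ /= qserZ coefw_wrd.
have Fw_zero : ~~ ((size w == (2 * n)%N) && catalan w) -> ycomp n (Fw 1) w = 0.
  move=> nw; rewrite /ycomp /yscale; have [e|_] := eqVneq (ny w) n; last by rewrite mul0r.
  rewrite mul1r; apply: contraNeq nw => F0.
  have ps : psum w = 0 by rewrite (walk_homog F0) subrr.
  apply/andP; split.
    by move: ps; rewrite psum_size e => /eqP; rewrite subr_eq0.
  rewrite /catalan ps eqxx andbT; apply/allP => i; rewrite mem_iota => /andP[_ i_lt].
  have := walk1_pos F0 (i := i); rewrite -[X in X <= _ + _]addr0 lerD2l; apply.
  by case: (size w) i_lt => [|s] //=; rewrite ?addn0 ?add1n // => /ltnW.
have [sw|nsw] := eqVneq (size w) (2 * n)%N; last first.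
  rewrite Fw_zero ?(negPf nsw) // big1 // => t _.
  by case: eqP => [e|_]; rewrite ?mulr0 // -e size_tuple eqxx in nsw *.
have sw' : size w == (2 * n)%N by rewrite sw.
rewrite big_mkcond (bigD1 (Tuple sw')) //= [X in _ + X]big1 ?addr0 => [|t tn]; last first.
  case: ifP => // _; have [e|_] := eqVneq (val t) w; last by rewrite mulr0.
  by case/eqP: tn; apply: val_inj.
case: ifP => [cw|/negbT ncw]; last by rewrite Fw_zero ?(negPf ncw) ?andbF.
have /andP[_ /eqP ps] := cw.
have e : ny w = n.
  move/eqP: ps; rewrite psum_size sw subr_eq0 => /eqP[/eqP].
  by rewrite eqn_mul2l /= => /eqP.
rewrite eqxx mulr1 /ycomp /yscale e eqxx mul1r walk1_prod ps addr0 eqxx mul1r.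
(* The product in [Ccat] has one factor more than the walk has steps: the final height 1,
   contributing [[1] = 1]. *)
by rewrite big_ord_recr /= [take (2 * n) w]take_oversize ?sw // ps addr0 qintE qnat1 // mulr1.
Qed.

(** Height 0 is entered by a step [y] from height 1, of weight [[1] = 1]. Thus [P] collects the
    words of the [x C y]. *)
Lemma walk0_rcons m w a : D m (rcons w a) = if a then 0 else Fw m w.
Proof.
elim: w m => [|b w IH] m; last first.
  by rewrite /= -[LHS]/(qnat q m * D _ (rcons w a)) IH {IH}; case: a; rewrite ?mulr0.
rewrite /D /Fw /=; case: a; first by rewrite mulr0.
by case: m => [|[|m]]; rewrite /= ?qnat0 ?qnat1 ?mul0r ?mulr1 ?mulr0.
Qed.

Lemma coefw_xCy n : coefw (wrd F [:: true] * Ccat q n * wrd F [:: false]) = ycomp n.+1 P.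
Proof.
apply: qserP => w; rewrite -mulrA /ycomp /yscale.
case: w => [|a w]; first by rewrite coefw_letterM0 mulr0.
rewrite coefw_letterM; case: a; last by rewrite mul0r mulr0.
rewrite mul1r /= add0n; case/lastP: w => [|w b].
  by rewrite coefw_Mletter0 mul0r.
rewrite coefw_Mletter coefw_Ccat walk0_rcons /ny -cats1 count_cat /= addn0 -/(ny w).
case: b => /=; first by rewrite mul0r mulr0.
by rewrite mul1r addn1 eqSS.
Qed.
End Coefficients.

(** * Images of Damiani's and Beck's elements *)

Section Homogeneous.
Context (F : fieldType) (q : F) (q_neq0 : q != 0).
Local Notation T := (qser q_neq0).
Local Notation "[ m ]" := (qnat q m).
Local Notation k := (q - q^-1).
Local Notation D := (walk0 q_neq0).
Local Notation Fw := (walk1 q_neq0).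
Local Notation X := (letter q_neq0 true).
Local Notation Y := (letter q_neq0 false).
Local Notation XY := (wordxy q_neq0).
Implicit Types (f h : T) (a b : bool) (u w : seq bool) (c : F).

Lemma ycomp_supp f d n : (forall w, f w != 0 -> ny w = d) ->
  ycomp n f = if n == d then f else 0.
Proof.
move=> fd; apply: qserP => w; rewrite /ycomp /yscale.
have [f0|/fd ->] := eqVneq (f w) 0; first by rewrite f0 mulr0; case: ifP.
by rewrite eq_sym; case: (n == d); rewrite ?mul1r // mulr0n mul0r.
Qed.

Lemma ycompM_suppr f h d n : (forall w, h w != 0 -> ny w = d) ->
  ycomp (n + d) (f * h) = ycomp n f * h.
Proof.
move=> hd; rewrite ycompM.
have n_lt : (n < (n + d).+1)%N by rewrite ltnS leq_addr.
rewrite (bigD1 (Ordinal n_lt)) //= (ycomp_supp _ hd) addKn eqxx big1 ?addr0 // => j.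
rewrite -val_eqE /= => jn; rewrite (ycomp_supp _ hd).
case: eqP => [e|_]; last by rewrite mulr0.
by have /eqP := subnKC (leq_ord j); rewrite e eqn_add2r (negPf jn).
Qed.
Lemma ycompM_suppl f h d n : (forall w, h w != 0 -> ny w = d) ->
  ycomp (d + n) (h * f) = h * ycomp n f.
Proof.
move=> hd; rewrite ycompM.
have d_lt : (d < (d + n).+1)%N by rewrite ltnS leq_addr.
rewrite (bigD1 (Ordinal d_lt)) //= (ycomp_supp _ hd) addKn eqxx big1 ?addr0 // => j.
rewrite -val_eqE /= => /negPf jd; rewrite (ycomp_supp _ hd).
by rewrite jd mul0r.
Qed.

Lemma ny_letterx w : X w != 0 -> ny w = 0%N.
Proof. by rewrite /letter; have [->|] := eqVneq w [:: true]; rewrite ?eqxx. Qed.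
Lemma ny_lettery w : Y w != 0 -> ny w = 1%N.
Proof. by rewrite /letter; have [->|] := eqVneq w [:: false]; rewrite ?eqxx. Qed.
Lemma ny_wordxy w : XY w != 0 -> ny w = 1%N.
Proof. by rewrite /XY; have [->|] := eqVneq w [:: true; false]; rewrite ?eqxx. Qed.

Hypothesis q2_neq1 : q ^+ 2 != 1.

(** The words [yx] cancel, and [xy] keeps the coefficient [q^-4 - 1]. *)
Lemma Edelta_shuffle : q ^- 2 *: (Y * X) - X * Y = - (q ^- 2 * k * (q + q^-1)) *: XY.
Proof.
apply: qserP => -[|a u].
  rewrite qserB !qserZ !qserM_mulw !mulw_nil /letter /XY /=.
  by rewrite !mulr0n !mulr0 subrr.
rewrite qserB !qserZ !qserM_mulw !mulw_cons !lder_letter !twist_letter.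
rewrite -[XY (a :: u)]/(lder a XY u) lder_wordxy.
case: a => /=; rewrite !mulwZl !mulwZr !mulw1l !mulw1r ?qser0; field;
  by rewrite ?q_neq0.
Qed.

(** The bracket of [D 1] with [XY] is [k *: (Y - D 1)], and [Y] disappears in degree at least 2;
    what remains mirrors the recursion of [Ea1]. *)
Lemma walk0_1_bracket n : ycomp n.+1 (D 1) * XY - XY * ycomp n.+1 (D 1)
  = - k *: ycomp n.+2 (D 1).
Proof.
have e : D 1 * XY - XY * D 1 = k *: (Y - D 1).
  apply: qserP => u; rewrite qserB qserZ qserB !qserM_mulw.
  have := walk0_wordxy q_neq0 q2_neq1 1 u; rewrite /= qnat1 // walk0_0 mulw1l expr1 divff //.
  by rewrite mulr1 mul1r => /eqP; rewrite subr_eq0 => /eqP.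
have /(congr1 (ycomp n.+2)) := e; rewrite linearB linearZ linearB /=.
rewrite (ycomp_supp _ ny_lettery) /= sub0r scalerN -scaleNr => <-.
by rewrite -{1}(addn1 n.+1) (ycompM_suppr _ _ ny_wordxy) -(add1n n.+1) (ycompM_suppl _ _ ny_wordxy).
Qed.

Lemma ycomp1_walk0_1 : ycomp 1 (D 1) = Y.
Proof.
apply: qserP => w; rewrite /ycomp /yscale.
have [D0|D0] := eqVneq (D 1 w) 0.
  rewrite D0 mulr0 /letter; have [e|_] := eqVneq w [:: false]; last by [].
  by move/eqP: D0; rewrite e /D /= qnat1 // mul1r oner_eq0.
have [n1|n1] := eqVneq (ny w) 1%N; last first.
  rewrite mul0r /letter; have [e|] := eqVneq w [:: false] => //.
  by rewrite e in n1.
have := walk_homog D0; rewrite psum_size n1 /=.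
case: w D0 n1 => [|a [|b w]] //.
by case: a => // _ _ _; rewrite /D /= qnat1 // !mul1r.
Qed.

Lemma walk0_1_letterx n : q ^- 2 *: (ycomp n.+1 (D 1) * X) - X * ycomp n.+1 (D 1)
  = - (q ^- 2 * k) *: ycomp n.+1 (Fw 1).
Proof.
have /(congr1 (ycomp n.+1)) := walk1_eq q_neq0 q2_neq1.
rewrite linearB linearZ linearB linearZ /=.
rewrite -{4}(addn0 n.+1) (ycompM_suppr _ _ ny_letterx).
rewrite -{3}(add0n n.+1) (ycompM_suppl _ _ ny_letterx).
have -> : ycomp n.+1 (1 : T) = 0.
  by apply: qserP => -[|a u]; rewrite /ycomp /yscale /= ?mulr0n ?mul0r ?mulr0.
rewrite subr0 => ->; rewrite scalerA.
have -> : - (q ^- 2 * k) / k = - q ^- 2 by rewrite mulNr mulfK ?qqV_neq0.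
by rewrite scalerBr scalerA mulNr mulVf ?expf_neq0 // scaleN1r scaleNr opprK addrC.
Qed.
End Homogeneous.

(** * Transfer along the homomorphism *)

Section Transfer.
Context (F : fieldType) (q : F) (q_neq0 : q != 0).
Hypothesis F_char0 : [pchar F] =i pred0.
Hypothesis q_nroot : forall n : nat, (0 < n)%N -> q ^+ n != 1.
Local Notation T := (qser q_neq0).
Local Notation "[ m ]" := (qnat q m).
Local Notation k := (q - q^-1).
Local Notation D := (walk0 q_neq0).
Local Notation Fw := (walk1 q_neq0).
Local Notation P := (xwalk q_neq0).
Let q2_neq1 : q ^+ 2 != 1. Proof. exact: q_nroot. Qed.
(** The scalar gained at each step of [Ea1]: [- q ^- 2 * k] from [Edelta_shuffle] divided by
    [q + q^-1], times [- k] from [walk0_1_bracket]. *)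
Let lam := q ^- 2 * k ^+ 2.

Lemma qqV_add_neq0 : q + q^-1 != 0.
Proof.
have : q ^+ 4 != 1 by exact: q_nroot.
apply: contraNneq => /eqP; rewrite addr_eq0 => /eqP e.
have e2 : q ^+ 2 = -1 by rewrite expr2 {2}e mulrN divff.
by rewrite (exprM q 2 2) e2 sqrrN expr1n.
Qed.

(** [walk1_recurrence] is the recurrence of an exponential with exponent coefficients [[2 * j] / j];
    powers of [lam] follow the degree and are compatible with it. *)
Lemma expcoef_walk1 n :
  expcoef (fun j : nat => if j is 0 then 0
                          else ([2 * j] / j%:R * lam ^+ j) *: ycomp j P) n
  = lam ^+ n *: ycomp n (Fw 1).
Proof.
apply: (@eq_expcoef F T F_char0 (fun n => lam ^+ n *: ycomp n (Fw 1))) => //.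
- move=> [|i] [|j]; [exact: commr0 | exact/commr_sym/commr0 | exact: commr0 |].
  by apply/commrZ/commr_sym/commrZ/ycomp_xwalk_comm.
- by rewrite expr0 scale1r ycomp0_walk1.
move=> {}n; rewrite scalerA mulrC -scalerA walk1_recurrence // big_ord_recl /= muln0 qnat0.
rewrite scale0r add0r scaler_sumr; apply: eq_bigr => j _.
rewrite /bump /= add1n subSS -scalerAl -scalerAr !scalerA; congr (_ *: _).
have -> : lam ^+ n.+1 = lam ^+ j.+1 * lam ^+ (n - j).
  by rewrite -exprD addSn subnKC // -ltnS.
have := natF_neq0 F_char0 j.
move: (j.+1%:R : F) (lam ^+ j.+1) (lam ^+ (n - j)) [2 * j.+1] => x y z t x0.
by field.
Qed.

Context (U : algType F) (phi : {linear U -> T}).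
Hypothesis phi1 : phi 1 = 1.
Hypothesis phiM : {morph phi : a b / a * b}.

Lemma phi_pcoef (p : nat -> U) m n : phi (pcoef p m n) = pcoef (phi \o p) m n.
Proof.
elim: m n => [|m IH] n /=.
  by case: (n == 0%N); rewrite ?linear0 //; exact: phi1.
by rewrite linear_sum; apply: eq_bigr => j _; rewrite /= phiM IH.
Qed.
Lemma phi_expcoef (p : nat -> U) n : phi (expcoef p n) = expcoef (phi \o p) n.
Proof.
rewrite /expcoef linear_sum; apply: eq_bigr => m _.
by rewrite linearZ /= phi_pcoef.
Qed.

Context (A B : U).
Hypothesis phiA : phi A = letter q_neq0 true.
Hypothesis phiB : phi B = letter q_neq0 false.

Lemma phi_Edelta : phi (Edelta q A B) = - (q ^- 2 * k * (q + q^-1)) *: wordxy q_neq0.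
Proof. by rewrite /Edelta linearB linearZ /= !phiM phiA phiB Edelta_shuffle. Qed.

Lemma phi_Ea1 n : phi (Ea1 q A B n) = lam ^+ n *: ycomp n.+1 (D 1).
Proof.
elim: n => [|n IH] /=; first by rewrite expr0 scale1r ycomp1_walk0_1.
rewrite linearZ linearB /= !phiM phi_Edelta IH -!scalerAl -!scalerAr !scalerA.
rewrite [X in _ - X *: _]mulrC -scalerBr walk0_1_bracket // !scalerA; congr (_ *: _).
rewrite [lam ^+ n.+1]exprS; move: (lam ^+ n) => L; have s0 := qqV_add_neq0.
apply: (mulfI s0); rewrite /lam !mulrA mulfV //.
by field.
Qed.

Lemma phi_Endelta n : (0 < n)%N ->
  - (k *: phi (Endelta q A B n)) = lam ^+ n *: ycomp n (Fw 1).
Proof.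
case: n => // n _; rewrite /Endelta linearB [phi (_ *: _)]linearZ /= !phiM phi_Ea1 phiA.
rewrite -scalerAl -scalerAr scalerA [q ^- 2 * _]mulrC -scalerA -scalerBr walk0_1_letterx //.
rewrite !scalerA -scaleNr; congr (_ *: _).
rewrite [lam ^+ n.+1]exprS; move: (lam ^+ n) => L; rewrite /lam; ring.
Qed.

(** The images of [k *: Eb j] and the scaled components of [P] have the same exponential, so
    [expcoef_inj] identifies them. *)
Lemma phi_Beck (Eb : nat -> U) : is_Beck q A B Eb -> forall n, (0 < n)%N ->
  phi (Eb n) = ([2 * n] / n%:R * q ^- (2 * n) * k ^+ (2 * n).-1) *: ycomp n P.
Proof.
move=> hEb n n_gt0.
pose p j := if j is 0 then 0 else k *: Eb j.
have ee m : (0 < m)%N -> expcoef (phi \o p) m = expcoef (fun j : nat =>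
    if j is 0 then 0 else ([2 * j] / j%:R * lam ^+ j) *: ycomp j P) m.
  by move=> m_gt0; rewrite expcoef_walk1 -phi_expcoef hEb // linearN linearZ phi_Endelta.
have := expcoef_inj (linear0 phi) (erefl 0) ee n.
case: n n_gt0 => // n _ /=; rewrite linearZ /= => /(congr1 (fun f => k^-1 *: f)).
have k0 : k != 0 by exact: qqV_neq0.
rewrite !scalerA mulVf // scale1r => ->; congr (_ *: _).
have e : lam ^+ n.+1 = q ^- (2 * n.+1) * (k * k ^+ (2 * n.+1).-1).
  by rewrite -exprS prednK // /lam exprMn exprVn -!exprM.
by rewrite e mulrCA [k^-1 * _]mulrCA mulKf // mulrA.
Qed.
End Transfer.

Unset Implicit Arguments.

Theorem theorem7p1
  (F : fieldType) (hchar : [pchar F] =i pred0)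
  (q : F) (hq0 : q != 0) (hqroot : forall k : nat, (0 < k)%N -> q ^+ k != 1)
  (* an F-algebra U with elements A, B satisfying the q-Serre relations
     (e.g. U = U^+_q with its generators) *)
  (U : algType F) (A B : U)
  (serreA : qcomm 1 A (qcomm q^-1 A (qcomm q A B)) = 0)
  (serreB : qcomm 1 B (qcomm q^-1 B (qcomm q B A)) = 0)
  (* natural : U -> (V, q-shuffle) an algebra homomorphism with A |-> x, B |-> y *)
  (natural : U -> Vfree F)
  (nat_lin : forall (c : F) (a b : U), natural (c *: a + b) = c *: natural a + natural b)
  (nat_one : natural 1 = wrd F [::])
  (nat_mul : forall a b : U, natural (a * b) = qstar q (natural a) (natural b))
  (nat_A : natural A = wrd F [:: lx])
  (nat_B : natural B = wrd F [:: ly])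
  (* Beck's elements, defined by the exponential generating identity *)
  (Eb : nat -> U) (hEb : is_Beck q A B Eb)
  (n : nat) (hn : (0 < n)%N) :
  natural (Eb n)
  = (qint q (2 * n)%N / n%:R * q ^- (2 * n) * (q - q^-1) ^+ (2 * n).-1)
      *: (wrd F [:: lx] * Ccat q n.-1 * wrd F [:: ly]).
Proof.
(* The identity is proved in the completed algebra, for [natural] followed by [coefw], and pulled
   back by [coefw_inj]. *)
have phi_lin : linear (fun u : U => coefw hq0 (natural u)).
  by move=> c a b; rewrite nat_lin linearP.
pose phiL := GRing.isLinear.Build F U (qser hq0) _ _ phi_lin.
pose phi : {linear U -> qser hq0} := HB.pack (fun u : U => coefw hq0 (natural u)) phiL.
have phi1 : phi 1 = 1 by rewrite /= nat_one coefw_wrd0.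
have phiM : {morph phi : a b / a * b}.
  by move=> a b; rewrite /= nat_mul coefw_qstar.
have letterE a : coefw hq0 (wrd F [:: a]) = letter hq0 a.
  by apply: qserP => w; rewrite coefw_wrd eq_sym.
have phiA : phi A = letter hq0 true by rewrite /= nat_A letterE.
have phiB : phi B = letter hq0 false by rewrite /= nat_B letterE.
apply: (@coefw_inj _ _ hq0).
rewrite linearZ /= qintE.
have := phi_Beck hchar hqroot phi1 phiM phiA phiB hEb hn => /= ->.
by case: n hn => // n _; rewrite coefw_xCy // hqroot.
Qed.
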